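(* Let $X$ be a simply connected geodesic metric space and let $\bar X$ be its Higson compactification. Then for some index set $\mathcal A$ there is an isomorphism $$\check H^1(\bar X)\cong\bigoplus_{\mathcal A}\mathbb Q,$$ where $\check H^1$ denotes Čech cohomology with integer coefficients.
   Context: A metric space $X$ is geodesic if for all $x,y\in X$ there is an isometric embedding $\xi:[0,d(x,y)]\to X$ with $\xi(0)=x$, $\xi(d(x,y))=y$. Let $(X,d)$ be a metric space with base point $x_0$, and let $B(x,r)$ be the open ball of radius $r$ centered at $x$. A map $f:X\to Y$ to a metric space is slowly oscillating if for every $r>0$ the diameter of $f(B(x,r))$ tends to $0$ as $d(x,x_0)\to\infty$. Let $C_h$ be the ring of all bounded continuous slowly oscillating functions $f:X\to\mathbb R$. The Higson compactification $\bar X$ of $X$ is the closure of the image of $X$ under the embedding $(f)_{f\in C_h}:X\to\prod_{f\in C_h}[\inf f,\sup f]$. *)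

(* Defs.v *)
From HB Require Import structures.
From mathcomp Require Import all_boot all_order all_algebra.
From mathcomp Require Import generic_quotient zify.
From mathcomp Require Import all_classical all_reals all_analysis.

Set Implicit Arguments.
Unset Strict Implicit.
Unset Printing Implicit Defensive.

Import Order.TTheory GRing.Theory Num.Theory.
Import numFieldNormedType.Exports.
Local Open Scope classical_set_scope.
Local Open Scope ring_scope.
Local Open Scope quotient_scope.

(* Maps defined on [0, a] or [0, 1] x [0, 1] are represented by total functions
   on [R] or [R * R], constrained only on that domain. *)
Definition geodesic (R : realType) (X : metricType R) : Prop :=
  forall x y : X, exists xi : R -> X,
    [/\ {in `[0, mdist x y] &, forall s t, mdist (xi s) (xi t) = `|s - t|},
        xi 0 = x & xi (mdist x y) = y].

Definition path_connected (R : realType) (X : topologicalType) : Prop :=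
  forall x y : X, exists g : R -> X,
    [/\ {within `[0, 1], continuous g}, g 0 = x & g 1 = y].

Definition simply_connected (R : realType) (X : topologicalType) : Prop :=
  path_connected R X /\
  forall g : R -> X, {within `[0, 1], continuous g} -> g 0 = g 1 ->
    exists H : R * R -> X,
      [/\ {within `[0, 1] `*` `[0, 1], continuous H},
          {in `[0, 1], forall s, H (s, 0) = g s},
          {in `[0, 1], forall s, H (s, 1) = g 0} &
          {in `[0, 1], forall t, H (0, t) = g 0 /\ H (1, t) = g 0}].

Definition diameter (R : realType) (Y : metricType R) (A : set Y) : \bar R :=
  ereal_sup [set (mdist p.1 p.2)%:E | p in A `*` A].

Definition slowly_oscillating (R : realType) (X Y : metricType R) (x0 : X)
    (f : X -> Y) : Prop :=
  forall r : R, 0 < r -> forall e : R, 0 < e -> exists M : R,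
    forall x : X, M < mdist x x0 -> (diameter (f @` ball x r) < e%:E)%E.

(* The real line as a metric space is [R^o], with [mdist x y = `|y - x|]. *)
Section Higson.
Context {R : realType} {X : metricType R} (x0 : X).

Definition higson_functions : set (X -> R^o) :=
  [set f : X -> R^o | [/\ bounded_fun f, continuous f &
                         slowly_oscillating (Y := R^o) x0 f]].

Definition higson_interval (f : higson_functions) : topologicalType :=
  set_type `[inf (range (set_val f)), sup (range (set_val f))]%classic.

Definition higson_cube : topologicalType := prod_topology higson_interval.

Lemma higson_in_interval (f : higson_functions) (x : X) :
  set_val f x \in
    (`[inf (range (set_val f)), sup (range (set_val f))]%classic : set R).
Proof.
case: f => f /= fP; rewrite set_valE /=; have [bf _ _] := set_mem fP.
apply/mem_set; rewrite /= in_itv /=; apply/andP; split.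
- by apply: ge_inf; [exact: bounded_fun_has_lbound | exists x].
- by apply: ub_le_sup; [exact: bounded_fun_has_ubound | exists x].
Qed.

Definition higson_embedding (x : X) : higson_cube :=
  fun f => exist _ (set_val f x) (higson_in_interval f x).

Definition higson : topologicalType :=
  set_type (closure (range higson_embedding)).

End Higson.

(* First Cech cohomology of a space [T] with coefficients in [int]: the direct
   limit, over all open covers [U] of [T] ordered by refinement, of the first
   cohomology of the nerve of [U], computed with ordered simplicial cochains.
   A cover is a set of open sets. A 0- or 1-cochain on its nerve is represented
   by a total function on (pairs of) sets; only its values on members of [U]
   with nonempty intersection, i.e. on simplices of the nerve, are ever used. *)
Section CechH1.
Context {T : topologicalType}.
Implicit Types (U V W : set (set T)) (p q : set T -> set T).
Implicit Types (c d : set T -> set T -> int).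

Definition open_cover U : Prop :=
  U `<=` open /\ \bigcup_(u in U) u = [set: T].

Definition cocycle1 U c : Prop :=
  forall u v w, U u -> U v -> U w -> u `&` v `&` w !=set0 ->
    c v w - c u w + c u v = 0.

Definition coboundary1 U c : Prop :=
  exists b : set T -> int, forall u v, U u -> U v -> u `&` v !=set0 ->
    c u v = b v - b u.

Definition refinement W U p : Prop :=
  forall w, W w -> U (p w) /\ w `<=` p w.

Definition pullback1 p c : set T -> set T -> int := fun u v => c (p u) (p v).

Record cech_cocycle := CechCocycle {
  cech_cover : set (set T);
  cech_cochain : set T -> set T -> int;
  cech_coverP : open_cover cech_cover;
  cech_cochainP : cocycle1 cech_cover cech_cochain }.

HB.instance Definition _ := gen_eqMixin cech_cocycle.
HB.instance Definition _ := gen_choiceMixin cech_cocycle.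

Implicit Types r s t : cech_cocycle.

(* Cocycles on two covers have the same class in the direct limit. *)
Definition cech_cohomologous r s : Prop :=
  exists W p q, [/\ open_cover W, refinement W (cech_cover r) p,
    refinement W (cech_cover s) q &
    coboundary1 W (pullback1 p (cech_cochain r) - pullback1 q (cech_cochain s))].

Lemma coboundary1D U c d :
  coboundary1 U c -> coboundary1 U d -> coboundary1 U (c + d).
Proof.
move=> [a ha] [b hb]; exists (a + b) => u v Uu Uv uv.
by rewrite !fctE ha // hb // opprD addrACA.
Qed.

Lemma coboundary1N U c : coboundary1 U c -> coboundary1 U (- c).
Proof.
move=> [a ha]; exists (- a) => u v Uu Uv uv.
by rewrite !fctE ha // opprB opprK addrC.
Qed.

Lemma coboundary10 U : coboundary1 U 0.
Proof. by exists 0 => u v _ _ _; rewrite subrr. Qed.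

Lemma coboundary1_pullback W U p c :
  refinement W U p -> coboundary1 U c -> coboundary1 W (pullback1 p c).
Proof.
move=> Wp [b hb]; exists (b \o p) => u v Wu Wv [x [ux vx]].
have [[Uu up] [Uv vp]] := (Wp u Wu, Wp v Wv).
by apply: hb => //; exists x; split; [exact: up | exact: vp].
Qed.

Lemma cocycle1_pullback W U p c :
  refinement W U p -> cocycle1 U c -> cocycle1 W (pullback1 p c).
Proof.
move=> Wp cc u v w Wu Wv Ww [x [[ux vx] wx]].
have [Uu up] := Wp u Wu; have [Uv vp] := Wp v Wv; have [Uw wp] := Wp w Ww.
by apply: cc => //; exists x; split; [split; [exact: up | exact: vp] | exact: wp].
Qed.

(* Two refinement maps induce the same map in cohomology. *)
Lemma pullback1_indep W U p q c :
  cocycle1 U c -> refinement W U p -> refinement W U q ->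
  coboundary1 W (pullback1 p c - pullback1 q c).
Proof.
move=> cc Wp Wq; exists (fun w => - c (p w) (q w)) => u v Wu Wv [x [ux vx]].
have [[Up up] [Vp vp]] := (Wp u Wu, Wp v Wv).
have [[Uq uq] [Vq vq]] := (Wq u Wu, Wq v Wv).
have h1 : c (p v) (q v) - c (p u) (q v) + c (p u) (p v) = 0.
  by apply: cc => //; exists x; split; [split; [exact: up | exact: vp] | exact: vq].
have h2 : c (q u) (q v) - c (p u) (q v) + c (p u) (q u) = 0.
  by apply: cc => //; exists x; split; [split; [exact: up | exact: uq] | exact: vq].
rewrite !fctE /pullback1; lia.
Qed.

Lemma refinement_comp W V U p q :
  refinement W V p -> refinement V U q -> refinement W U (q \o p).
Proof.
move=> Wp Vq w Ww; have [Vp wp] := Wp w Ww; have [Uq vq] := Vq _ Vp.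
by split => //; exact: subset_trans vq.
Qed.

Lemma refinement_id U : refinement U U id.
Proof. by move=> u Uu; split. Qed.

Definition cover_meet U V : set (set T) :=
  [set uv.1 `&` uv.2 | uv in U `*` V].

Definition cover_meet_proj U V (w : set T) : set T * set T :=
  xget (set0, set0) [set uv | (U `*` V) uv /\ uv.1 `&` uv.2 = w].

Lemma open_cover_meet U V :
  open_cover U -> open_cover V -> open_cover (cover_meet U V).
Proof.
move=> [oU cU] [oV cV]; split.
  by move=> _ [[u v] /= [Uu Vv] <-]; apply: openI; [exact: oU | exact: oV].
rewrite -subTset => x _.
have [u Uu ux] : (\bigcup_(u in U) u) x by rewrite cU.
have [v Vv vx] : (\bigcup_(v in V) v) x by rewrite cV.
by exists (u `&` v) => //; exists (u, v).
Qed.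

Lemma cover_meet_projP U V w : cover_meet U V w ->
  [/\ U (cover_meet_proj U V w).1, V (cover_meet_proj U V w).2 &
      (cover_meet_proj U V w).1 `&` (cover_meet_proj U V w).2 = w].
Proof.
move=> [uv UVuv <-]; rewrite /cover_meet_proj; case: xgetP => [[u v] _ [[]]//|].
by move=> /(_ uv) /=; case; split.
Qed.

Lemma refinement_meet1 U V :
  refinement (cover_meet U V) U (fun w => (cover_meet_proj U V w).1).
Proof.
by move=> w /cover_meet_projP[Uu _ e]; split => //; rewrite -{1}e; exact: subIsetl.
Qed.

Lemma refinement_meet2 U V :
  refinement (cover_meet U V) V (fun w => (cover_meet_proj U V w).2).
Proof.
by move=> w /cover_meet_projP[_ Vv e]; split => //; rewrite -{1}e; exact: subIsetr.
Qed.

Lemma refinement_meet W U V p q : refinement W U p -> refinement W V q ->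
  refinement W (cover_meet U V) (fun w => p w `&` q w).
Proof.
move=> Wp Wq w Ww; have [Up wp] := Wp w Ww; have [Vq wq] := Wq w Ww.
by split; [exists (p w, q w) | move=> x wx; split; [exact: wp | exact: wq]].
Qed.

(* [c] represents the restriction of the class of [r] to the finer cover [W]. *)
Definition restricts r W c : Prop :=
  exists p, refinement W (cech_cover r) p /\
    coboundary1 W (pullback1 p (cech_cochain r) - c).

Lemma restricts_self r : restricts r (cech_cover r) (cech_cochain r).
Proof.
exists id; split; first exact: refinement_id.
by rewrite [_ - _]subrr; exact: coboundary10.
Qed.

Lemma restricts_refinement r W c V p :
  restricts r W c -> refinement V W p -> restricts r V (pullback1 p c).
Proof.
move=> [q [Wq cq]] Vp; exists (q \o p); split; first exact: refinement_comp Wq.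
exact: (coboundary1_pullback Vp cq).
Qed.

Lemma restricts_uniq r W c d :
  restricts r W c -> restricts r W d -> coboundary1 W (c - d).
Proof.
move=> [p [Wp cp]] [q [Wq cq]].
have h := coboundary1D (coboundary1N cp)
  (coboundary1D (pullback1_indep (@cech_cochainP r) Wp Wq) cq).
by move: h; rewrite [pullback1 p _ - _ + _]addrA subrK opprB -addrA addKr.
Qed.

Lemma restricts_coboundary r W c d :
  restricts r W c -> coboundary1 W (c - d) -> restricts r W d.
Proof.
move=> [p [Wp cp]] cd; exists p; split => //.
by have := coboundary1D cp cd; rewrite addrA subrK.
Qed.

Lemma cech_cohomologousP r s : cech_cohomologous r s <->
  exists W c, [/\ open_cover W, restricts r W c & restricts s W c].
Proof.
split=> [[W [p [q [oW Wp Wq cb]]]]|[W [c [oW [p [Wp cp]] [q [Wq cq]]]]]].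
- exists W, (pullback1 q (cech_cochain s)); split => //; first by exists p.
  by exists q; split=> //; rewrite subrr; exact: coboundary10.
- exists W, p, q; split => //.
  by have := coboundary1D cp (coboundary1N cq); rewrite opprB addrA subrK.
Qed.

Lemma restricts_meet r s : exists W c d,
  [/\ open_cover W, restricts r W c & restricts s W d].
Proof.
exists (cover_meet (cech_cover r) (cech_cover s)).
do 2 eexists; split; first by apply: open_cover_meet; exact: cech_coverP.
- exact: restricts_refinement (restricts_self r) (@refinement_meet1 _ _).
- exact: restricts_refinement (restricts_self s) (@refinement_meet2 _ _).
Qed.

Lemma cech_cohomologous_restricts r s W c d :
  open_cover W -> restricts r W c -> restricts s W d -> coboundary1 W (c - d) ->
  cech_cohomologous r s.
Proof.
move=> oW rc sd cd; apply/cech_cohomologousP; exists W, d; split=> //.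
exact: restricts_coboundary cd.
Qed.

Lemma cech_cohomologous_refl r : cech_cohomologous r r.
Proof.
apply/cech_cohomologousP; do 2 eexists.
by split; [exact: (cech_coverP r) | exact: restricts_self | exact: restricts_self].
Qed.

Lemma cech_cohomologous_sym r s : cech_cohomologous r s -> cech_cohomologous s r.
Proof.
by move=> /cech_cohomologousP[W [c [? ? ?]]]; apply/cech_cohomologousP; exists W, c.
Qed.

Lemma cech_cohomologous_trans s r t :
  cech_cohomologous r s -> cech_cohomologous s t -> cech_cohomologous r t.
Proof.
move=> /cech_cohomologousP[W [c [oW rc sc]]] /cech_cohomologousP[V [d [oV sd td]]].
have m1 := @refinement_meet1 W V; have m2 := @refinement_meet2 W V.
apply: (cech_cohomologous_restricts (open_cover_meet oW oV)
  (restricts_refinement rc m1) (restricts_refinement td m2)).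
exact: restricts_uniq (restricts_refinement sc m1) (restricts_refinement sd m2).
Qed.

Definition cech_equiv r s : bool := `[< cech_cohomologous r s >].

Lemma cech_equiv_refl : reflexive cech_equiv.
Proof. by move=> r; apply/asboolP; exact: cech_cohomologous_refl. Qed.

Lemma cech_equiv_sym : symmetric cech_equiv.
Proof.
by move=> r s; apply: asbool_equiv_eq; split; exact: cech_cohomologous_sym.
Qed.

Lemma cech_equiv_trans : transitive cech_equiv.
Proof.
move=> s r t /asboolP rs /asboolP st; apply/asboolP.
exact: cech_cohomologous_trans st.
Qed.

Canonical cech_equiv_rel :=
  EquivRel cech_equiv cech_equiv_refl cech_equiv_sym cech_equiv_trans.

Lemma open_cover_setT : open_cover [set [set: T]].
Proof.
by split=> [_ ->|]; [exact: openT | rewrite bigcup_set1].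
Qed.

Lemma cocycle10 U : cocycle1 U 0.
Proof. by []. Qed.

Lemma cocycle1N U c : cocycle1 U c -> cocycle1 U (- c).
Proof.
by move=> cc u v w Uu Uv Uw n; have := cc u v w Uu Uv Uw n; rewrite !fctE; lia.
Qed.

Lemma cocycle1D U c d : cocycle1 U c -> cocycle1 U d -> cocycle1 U (c + d).
Proof.
move=> cc cd u v w Uu Uv Uw n.
by have := cc u v w Uu Uv Uw n; have := cd u v w Uu Uv Uw n; rewrite !fctE; lia.
Qed.

Definition cocycle_zero : cech_cocycle :=
  CechCocycle open_cover_setT (@cocycle10 _).

Definition cocycle_opp r : cech_cocycle :=
  CechCocycle (cech_coverP r) (cocycle1N (@cech_cochainP r)).

Definition cocycle_add r s : cech_cocycle :=
  CechCocycle (open_cover_meet (cech_coverP r) (cech_coverP s))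
    (cocycle1D
      (cocycle1_pullback (@refinement_meet1 _ _) (@cech_cochainP r))
      (cocycle1_pullback (@refinement_meet2 _ _) (@cech_cochainP s))).

Lemma restricts_zero W : restricts cocycle_zero W 0.
Proof.
exists (fun=> setT); split; first by move=> w _; split.
by rewrite subr0; exact: coboundary10.
Qed.

Lemma restricts_opp r W c : restricts r W c -> restricts (cocycle_opp r) W (- c).
Proof.
move=> [p [Wp cp]]; exists p; split => //.
by have := coboundary1N cp; rewrite opprD.
Qed.

Lemma restricts_add r s W c d :
  restricts r W c -> restricts s W d -> restricts (cocycle_add r s) W (c + d).
Proof.
move=> rc sd; have [p [Wp _]] := rc; have [q [Wq _]] := sd.
have Wm := refinement_meet Wp Wq.
eexists; split; first exact: Wm.
have h1 := restricts_refinement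
  (restricts_refinement (restricts_self r) (@refinement_meet1 _ _)) Wm.
have h2 := restricts_refinement
  (restricts_refinement (restricts_self s) (@refinement_meet2 _ _)) Wm.
have := coboundary1D (restricts_uniq h1 rc) (restricts_uniq h2 sd).
by rewrite addrACA -opprD.
Qed.

Definition cech_H1 : Type := {eq_quot cech_equiv_rel}.

HB.instance Definition _ := Choice.on cech_H1.
HB.instance Definition _ := EqQuotient.on cech_H1.

Definition cech_class r : cech_H1 := \pi_cech_H1 r.

Lemma cech_class_eqP r s :
  cech_class r = cech_class s <-> cech_cohomologous r s.
Proof.
split=> [/(@eqmodP _ cech_equiv_rel)/asboolP //|h].
by apply/(@eqmodP _ cech_equiv_rel)/asboolP.
Qed.

Lemma cech_class_repr (x : cech_H1) : cech_class (repr x) = x.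
Proof. exact: reprK. Qed.

Definition cech_zero : cech_H1 := cech_class cocycle_zero.
Definition cech_opp (x : cech_H1) : cech_H1 := cech_class (cocycle_opp (repr x)).
Definition cech_add (x y : cech_H1) : cech_H1 :=
  cech_class (cocycle_add (repr x) (repr y)).

Lemma cech_class_opp r : cech_opp (cech_class r) = cech_class (cocycle_opp r).
Proof.
apply/cech_class_eqP/cech_cohomologousP.
have /cech_class_eqP/cech_cohomologousP[W [c [oW h1 h2]]] :=
  cech_class_repr (cech_class r).
by exists W, (- c); split => //; exact: restricts_opp.
Qed.

Lemma cech_class_add r s :
  cech_add (cech_class r) (cech_class s) = cech_class (cocycle_add r s).
Proof.
have /cech_class_eqP/cech_cohomologousP[W [c [oW h1 h2]]] :=
  cech_class_repr (cech_class r).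
have /cech_class_eqP/cech_cohomologousP[V [d [oV k1 k2]]] :=
  cech_class_repr (cech_class s).
have m1 := @refinement_meet1 W V; have m2 := @refinement_meet2 W V.
apply/cech_class_eqP/cech_cohomologousP; do 2 eexists.
split; first exact: open_cover_meet oW oV.
- by apply: restricts_add; [exact: restricts_refinement h1 m1
                           |exact: restricts_refinement k1 m2].
- by apply: restricts_add; [exact: restricts_refinement h2 m1
                           |exact: restricts_refinement k2 m2].
Qed.

Lemma cech_class_restricts r s W c :
  open_cover W -> restricts r W c -> restricts s W c ->
  cech_class r = cech_class s.
Proof. by move=> *; apply/cech_class_eqP/cech_cohomologousP; exists W, c. Qed.

Lemma cech_addC : commutative cech_add.
Proof.
move=> x y; rewrite -(cech_class_repr x) -(cech_class_repr y) !cech_class_add.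
have [W [c [d [oW h1 h2]]]] := restricts_meet (repr x) (repr y).
apply: (cech_class_restricts oW); first exact: restricts_add h1 h2.
by rewrite addrC; exact: restricts_add h2 h1.
Qed.

Lemma cech_add0 : left_id cech_zero cech_add.
Proof.
move=> x; rewrite -(cech_class_repr x) cech_class_add.
have h := restricts_self (repr x).
apply: (cech_class_restricts (cech_coverP (repr x)) _ h).
by rewrite -[X in restricts _ _ X]add0r; exact: restricts_add (restricts_zero _) h.
Qed.

Lemma cech_addN : left_inverse cech_zero cech_opp cech_add.
Proof.
move=> x; rewrite -(cech_class_repr x) cech_class_opp cech_class_add.
have h := restricts_self (repr x).
apply: (cech_class_restricts (cech_coverP (repr x)) _ (restricts_zero _)).
by rewrite -(addNr (cech_cochain (repr x))); exact: restricts_add (restricts_opp h) h.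
Qed.

Lemma cech_addA : associative cech_add.
Proof.
move=> x y z; rewrite -(cech_class_repr x) -(cech_class_repr y).
rewrite -(cech_class_repr z) !cech_class_add.
have [V [c [d [oV h1 h2]]]] := restricts_meet (repr x) (repr y).
have oZ := cech_coverP (repr z); have h3 := restricts_self (repr z).
have m1 := @refinement_meet1 V (cech_cover (repr z)).
have m2 := @refinement_meet2 V (cech_cover (repr z)).
have {}h1 := restricts_refinement h1 m1.
have {}h2 := restricts_refinement h2 m1.
have {}h3 := restricts_refinement h3 m2.
apply: (cech_class_restricts (open_cover_meet oV oZ)).
- exact: restricts_add h1 (restricts_add h2 h3).
- by rewrite addrA; exact: restricts_add (restricts_add h1 h2) h3.
Qed.

HB.instance Definition _ :=
  GRing.isZmodule.Build cech_H1 cech_addA cech_addC cech_add0 cech_addN.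

End CechH1.

Arguments cech_H1 : clear implicits.

(* Main.v *)
Require Import Defs.
From HB Require Import structures.
From mathcomp Require Import all_boot all_order all_algebra.
From mathcomp Require Import zify ring lra finmap.
From mathcomp Require Import all_classical all_reals all_analysis.
From mathcomp Require Import freeg.

(* The group is torsion-free because integral 1-cochains are: if [n c] is the
   coboundary of [b], then [c] is the coboundary of [b %/ n].

   It is divisible: let [c] be a cocycle on a finite cover [u_i] of the
   compactification, subordinate to functions [f_i] in [C_h]. As [X] is simply
   connected, the restriction of [c] to [X] is the coboundary of locally constant
   functions [m_i : X `&` u_i -> Z]. With the partition of unity [rho_k] defined by
   the [f_k], the function [F = \sum_k rho_k m_k] is continuous and slowly
   oscillating, though unbounded, since it differs from [m_i] on [u_i] by
   [\sum_k rho_k c i k]; far from the base point a ball lies in a single [u_i], where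
   [m_i] is constant on it because geodesics keep balls connected. The distance of
   [F] to [a + nZ] is then bounded, hence belongs to [C_h] and extends to the
   compactification. So the residue of [m_i] mod [n] becomes constant on the members
   of a refined cover, on which [c] is thus a coboundary mod [n].

   A torsion-free divisible group is a rational vector space, hence has a basis. *)

Set Implicit Arguments.
Unset Strict Implicit.
Unset Printing Implicit Defensive.

Import Order.TTheory GRing.Theory Num.Theory.
Import numFieldNormedType.Exports.
Local Open Scope classical_set_scope.
Local Open Scope ring_scope.

(** * Torsion-free divisible groups *)

Definition torsion_free (V : zmodType) : Prop :=
  forall (n : nat) (v : V), v *+ n.+1 = 0 -> v = 0.

Definition divisible (V : zmodType) : Prop :=
  forall (n : nat) (v : V), exists w, w *+ n.+1 = v.

(** * Existence of a basis of a vector space *)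

Section Basis.
Variables (F : fieldType) (L : lmodType F).
Implicit Types (B : set L) (D : {freeg L / F}).

Local Notation eval := (fglift (@id L) : {freeg L / F} -> L).

Definition supported_in B D : Prop := {in dom D, forall v, B v}.

(** An element of [{freeg L / F}] is a formal finite combination of distinct vectors, and [eval] is
    its value in [L]; independence says that no nonzero combination over [B] has value zero. *)
Definition lin_indep B : Prop := forall D, supported_in B D -> eval D = 0 -> D = 0.

Let evalB : {morph eval : x y / x - y}.
Proof. exact: lift_is_additive. Qed.

HB.instance Definition _ :=
  GRing.isZmodMorphism.Build {freeg L / F} L eval evalB.

Lemma evalE D : eval D = \sum_(v <- dom D) coeff v D *: v.
Proof.
rewrite -{1}[D]freeg_sumE raddf_sum; apply: eq_bigr => v _ /=.
exact: liftU.
Qed.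

Lemma evalZ a D : eval (a *: D) = a *: eval D.
Proof.
have -> : a *: D = fgscale a D by [].
rewrite raddf_sum evalE scaler_sumr; apply: eq_bigr => v _ /=.
by rewrite liftU scalerA.
Qed.

Lemma supported_inZ B a D : supported_in B D -> supported_in B (a *: D).
Proof. by move=> b v /domZ_subset/b. Qed.

Lemma supported_inU B a v : B v -> supported_in B << a *g v >>.
Proof.
move=> Bv w; have [->|a0] := eqVneq a 0; first by rewrite freegU0 dom0.
by rewrite domU // mem_seq1 => /eqP ->.
Qed.

(** A combination has finite support, so it is already supported in a single member of the chain.
    This is the chain condition for Zorn's lemma. *)
Lemma lin_indep_bigcup (C : set (set L)) : C `<=` lin_indep ->
  total_on C subset -> lin_indep (\bigcup_(B in C) B).
Proof.
move=> Ci Ct D; rewrite /supported_in => sD eD.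
have [[B CB]|C0] := pselect (exists B, C B); last first.
  apply/eqP; rewrite -dom_eq0; case: (dom D) sD => // v s /(_ v).
  by rewrite mem_head => /(_ isT)[B CB _]; case: C0; exists B.
suff [B' CB' sB'] : exists2 B', C B' & {in dom D, forall v, B' v}.
  exact: (Ci _ CB').
elim: (dom D) sD => [|v s IHs] sD; first by exists B.
have [|B1 CB1 sB1] := IHs; first by move=> w ws; apply: sD; rewrite inE ws orbT.
have [B2 CB2 B2v] := sD v (mem_head _ _).
have [B12|B21] := Ct _ _ CB1 CB2.
  by exists B2 => // w; rewrite inE => /orP[/eqP->//|/sB1/B12].
by exists B1 => // w; rewrite inE => /orP[/eqP->|/sB1//]; exact: B21.
Qed.

(** A maximal independent set spans: if [v] is not in the span, a relation over [B] and [v] cannot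
    involve [v], since dividing by its coefficient would express [v] over [B]; so [v] could be added
    to [B]. *)
Lemma exists_basis : exists2 B, lin_indep B &
  forall v, exists2 D, supported_in B D & eval D = v.
Proof.
have [B [iB mB]] := Zorn_bigcup lin_indep_bigcup.
exists B => // v; apply: contrapT => nv.
have nBv : ~ B v.
  by move=> Bv; apply: nv; exists << v >>; [exact: supported_inU | rewrite liftU scale1r].
apply: (mB (B `|` [set v])).
  by split; [move=> w Bw; left | move=> /(_ v) h; apply: nBv; apply: h; right].
move=> D sD eD; pose a := coeff v D; pose D' := D - << a *g v >>.
have sD' : supported_in B D'.
  move=> w; rewrite mem_dom coeffB coeffU => h.
  have [vw|vw] := eqVneq v w; first by move: h; rewrite vw eqxx mulr1 /a vw subrr eqxx.
  move: h; rewrite (negbTE vw) mulr0 subr0 -mem_dom => /sD[//|/= wv].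
  by rewrite wv eqxx in vw.
have eD' : eval D' = - (a *: v) by rewrite raddfB /= eD sub0r liftU.
have [a0|a0] := eqVneq a 0.
  have /(iB _ sD') : eval D' = 0 by rewrite eD' a0 scale0r oppr0.
  by rewrite /D' a0 freegU0 subr0.
case: nv; exists (- a^-1 *: D'); first exact: supported_inZ.
by rewrite evalZ eD' scalerN scaleNr opprK scalerA mulVf // scale1r.
Qed.

End Basis.

(** The map [phi] is the inverse of the evaluation [PSI] on formal combinations of basis vectors:
    independence makes [PSI] injective, spanning makes it surjective. *)
Theorem lmod_freeg (F : fieldType) (L : lmodType F) :
  exists (A : choiceType) (phi : {additive L -> {freeg A / F}}), bijective phi.
Proof.
have [B iB sB] := exists_basis L.
pose A : choiceType := set_type B.
pose psi : {freeg A / F} -> L := fglift (fun v : A => val v).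
have psiB : {morph psi : x y / x - y} by exact: lift_is_additive.
pose psia := GRing.isZmodMorphism.Build _ _ psi psiB.
pose PSI : {additive {freeg A / F} -> L} := HB.pack psi psia.
have psiE D : PSI D = \sum_(v <- dom D) coeff v D *: val v.
  rewrite -{1}[D]freeg_sumE (raddf_sum PSI); apply: eq_bigr => v _.
  exact: liftU.
have psi_inj : injective PSI.
  apply: raddf_inj => D D0.
  (* [D] is a combination over the subtype [A]; it is copied to one over [L] with the same
     coefficients, to which independence applies. *)
  pose D' : {freeg L / F} := \sum_(v <- dom D) << coeff v D *g val v >>.
  have cD' v : coeff (val v) D' = coeff v D.
    rewrite -[D in RHS]freeg_sumE /D' !raddf_sum; apply: eq_bigr => w _ /=.
    by rewrite !coeffU (inj_eq val_inj).
  have : D' = 0.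
    apply: iB.
      move=> w /dom_sum_subset; rewrite filter_predT => /flatten_mapP[v _].
      by apply: supported_inU; exact: set_valP.
    rewrite (raddf_sum (fglift (@id L))) -[RHS]D0 psiE; apply: eq_bigr => v _.
    exact: liftU.
  by move=> D'0; apply/eqP/freeg_eqP => v; rewrite -cD' D'0 !coeff0.
have psi_surj v : exists D, PSI D = v.
  have [D sD <-] := sB v; elim/freeg_ind_dom0: D sD => [|k x D xD k0 IHD] sD.
    by exists 0; rewrite (raddf0 PSI) raddf0.
  have dE w : w \in dom (<< k *g x >> + D) = (w == x) || (w \in dom D).
    rewrite domD domU // ?mem_seq1 // => y.
    by rewrite /= mem_seq1; have [->|] := eqVneq y x; rewrite ?(negbTE xD).
  have [D' eD'] : exists D', PSI D' = fglift (@id L) D.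
    by apply: IHD => w wD; apply: sD; rewrite dE wD orbT.
  have Bx : B x by apply: sD; rewrite dE eqxx.
  exists (<< k *g (exist _ x (mem_set Bx) : A) >> + D').
  rewrite raddfD eD' raddfD; congr (_ + _).
  by transitivity (k *: x); [exact: liftU | apply: esym; exact: liftU].
pose phi v := sval (cid (psi_surj v)).
have phiK : cancel phi PSI by move=> v; rewrite /phi; case: cid.
have psiK : cancel PSI phi by move=> D; apply: psi_inj; rewrite phiK.
have phiB : {morph phi : x y / x - y}.
  by move=> x y; apply: psi_inj; rewrite raddfB !phiK.
pose phia := GRing.isZmodMorphism.Build _ _ phi phiB.
pose PHI : {additive L -> {freeg A / F}} := HB.pack phi phia.
by exists A, PHI, PSI.
Qed.

(** * The rational structure of a torsion-free divisible group *)

Section RatSpace.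
Variables (V : zmodType) (tfV : torsion_free V) (dvV : divisible V).

Lemma torsion_freez (a : int) (v : V) : a != 0 -> v *~ a = 0 -> v = 0.
Proof.
case: a => [[|n]|n] // _; rewrite ?NegzE ?mulrNz; first exact: tfV.
by move=> /eqP; rewrite oppr_eq0 => /eqP; exact: tfV.
Qed.

Lemma divisiblez (a : int) (v : V) : a != 0 -> exists w, w *~ a = v.
Proof.
case: a => [[|n]|n] // _; first exact: dvV.
have [w <-] := dvV n v; exists (- w).
by rewrite NegzE mulrNz mulNrz opprK.
Qed.

(** A solution [w] of [w *~ denq q = v *~ numq q]: divisibility provides one, and torsion-freeness
    makes it unique. *)
Definition ratscale (q : rat) (v : V) : V :=
  sval (cid (divisiblez (v *~ numq q) (denq_neq0 q))).

(** Here the fraction need not be reduced, which is the form that sums and products of rationals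
    take in the module axioms. Both sides agree after multiplication by [denq q * b], which
    torsion-freeness cancels. *)
Lemma ratscaleE (a b : int) v w : b != 0 -> w *~ b = v *~ a ->
  ratscale (a%:~R / b%:~R) v = w.
Proof.
move=> b0 wv; rewrite /ratscale; set q := (_ / _ : rat); case: cid => /= u uE.
have d0 := denq_neq0 q.
apply/eqP; rewrite -subr_eq0; apply/eqP/(@torsion_freez (denq q * b)).
  by rewrite mulf_neq0.
have ad : a * denq q = numq q * b.
  apply/eqP; rewrite -(eqr_int rat) !rmorphM /=; apply/eqP.
  have <- : q * (denq q)%:~R = (numq q)%:~R.
    by rewrite -[q in q * _]divq_num_den mulfVK // intr_eq0.
  by rewrite mulrAC mulfVK // intr_eq0.
rewrite mulrzBl mulrzA uE -mulrzA -ad [denq q * b]mulrC [w *~ _]mulrzA wv -mulrzA.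
by rewrite subrr.
Qed.

Lemma ratscaleP q v : ratscale q v *~ denq q = v *~ numq q.
Proof. by rewrite /ratscale; case: cid. Qed.

Definition rat_space : Type := V.
HB.instance Definition _ := GRing.Zmodule.on rat_space.

Lemma ratscaleA a b v : ratscale a (ratscale b v) = ratscale (a * b) v.
Proof.
rewrite -[a in RHS]divq_num_den -[b in RHS]divq_num_den mulrACA -invfM -!intrM.
apply/esym/ratscaleE; first by rewrite mulf_neq0 ?denq_neq0.
rewrite mulrzA ratscaleP mulrzAC ratscaleP -mulrzA.
by rewrite mulrC.
Qed.

Lemma ratscale1 : left_id 1 ratscale.
Proof. by move=> v; rewrite -[1](@divr1 rat); exact: (@ratscaleE 1 1). Qed.

Lemma ratscaleDr : right_distributive ratscale +%R.
Proof.
move=> a v w; rewrite -[a in LHS]divq_num_den.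
by apply: ratscaleE; rewrite ?denq_neq0 // !mulrzDl !ratscaleP.
Qed.

Lemma ratscaleDl v : {morph ratscale^~ v : a b / a + b}.
Proof.
move=> a b; rewrite -[a in LHS]divq_num_den -[b in LHS]divq_num_den.
rewrite addf_div ?intr_eq0 ?denq_neq0 // -!intrM -intrD.
apply: ratscaleE; first by rewrite mulf_neq0 ?denq_neq0.
rewrite mulrzDl mulrzDr; congr (_ + _); first by rewrite mulrzA ratscaleP -mulrzA.
by rewrite mulrzA mulrzAC ratscaleP -mulrzA mulrC.
Qed.

HB.instance Definition _ := GRing.Zmodule_isLmodule.Build rat rat_space
  ratscaleA ratscale1 ratscaleDr ratscaleDl.

Theorem divisible_freeg :
  exists (A : choiceType) (phi : {additive V -> {freeg A / rat}}), bijective phi.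
Proof. exact: (lmod_freeg rat_space). Qed.

End RatSpace.

(** * Vanishing of the first cohomology of a simply connected space *)

Lemma within_continuousP (T U : topologicalType) (D : set T) (g : T -> U) :
  {within D, continuous g} <->
  (forall p, D p -> forall B, nbhs (g p) B -> \forall q \near p, D q -> B (g q)).
Proof.
have nbhsE p : D p -> nbhs (p : subspace D) = within D (nbhs p).
  by move=> Dp; rewrite {1}/nbhs /= -nbhs_subspace_in.
rewrite continuous_subspace_in; split=> h p.
  move=> Dp B gB; have /= := h p (mem_set Dp) _ gB.
  by rewrite nbhs_simpl /= nbhsE.
move=> /set_mem Dp B gB; rewrite nbhs_simpl /= nbhsE //.
exact: h.
Qed.

Lemma pairl_continuous (T U : topologicalType) (x : T) :
  continuous (fun y : U => (x, y)).
Proof.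
move=> y B [[B1 B2] [/= xB1 yB2] BB]; apply: filterS yB2 => z B2z.
by apply: BB; split=> //=; exact: nbhs_singleton.
Qed.

Lemma pairr_continuous (T U : topologicalType) (y : U) :
  continuous (fun x : T => (x, y)).
Proof.
move=> x B [[B1 B2] [/= xB1 yB2] BB]; apply: filterS xB1 => z B1z.
by apply: BB; split=> //=; exact: nbhs_singleton.
Qed.

Lemma within_comp (S T U : topologicalType) (D : set S) (E : set T)
    (phi : S -> T) (g : T -> U) : {within D, continuous phi} ->
  (forall p, D p -> E (phi p)) -> {within E, continuous g} ->
  {within D, continuous (g \o phi)}.
Proof.
move=> /within_continuousP phiC DE /within_continuousP gC; apply/within_continuousP.
move=> p Dp B gB; have := phiC p Dp _ (gC _ (DE p Dp) B gB).
by apply: filterS => q qB Dq; apply: qB => //; exact: DE.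
Qed.

(** * Integer-valued jump functions and their local primitives *)

Section Primitive.
Variables (T : topologicalType) (e : T -> T -> int).
Implicit Types (A D : set T) (h : T -> int).

Definition additive_on A : Prop :=
  forall p q r, A p -> A q -> A r -> e p q + e q r = e p r.

(** A discrete analogue of a closed 1-form: [e p q] is the jump from [p] to [q], and jumps add up
    near each point. A [primitive] is the corresponding antiderivative, whose differences give the
    jumps between nearby points only. *)
Definition loc_additive D : Prop :=
  forall p, D p -> exists2 A, nbhs p A & additive_on (D `&` A).

Definition primitive D h : Prop := forall p, D p -> exists2 A, nbhs p A &
  forall q r, (D `&` A) q -> (D `&` A) r -> e q r = h r - h q.

Lemma primitive_sub D D' h : D' `<=` D -> primitive D h -> primitive D' h.
Proof.
move=> D'D hP p /D'D/hP[A pA hA]; exists A => // q r [/D'D ? ?] [/D'D ? ?].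
exact: hA.
Qed.

Lemma loc_additive_sub D D' : D' `<=` D -> loc_additive D -> loc_additive D'.
Proof.
move=> D'D hP p /D'D/hP[A pA hA]; exists A => // q r s [/D'D ? ?] [/D'D ? ?] [/D'D ? ?].
exact: hA.
Qed.

Lemma additive_primitive D p : D p -> additive_on D -> primitive D (e p).
Proof.
move=> Dp eD q Dq; exists setT; first exact: filterT.
by move=> r s [Dr _] [Ds _]; rewrite -(eD p r s) // addrC addKr.
Qed.

(** The difference of two primitives is locally constant on [D], hence constant as [D] is
    connected. *)
Lemma primitive_uniq D h1 h2 : connected D -> primitive D h1 -> primitive D h2 ->
  forall p q, D p -> D q -> h1 q - h1 p = h2 q - h2 p.
Proof.
move=> cD hP1 hP2 p q Dp Dq; pose f r := h2 r - h1 r.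
suff fpq : f q = f p by move: fpq; rewrite /f; lia.
have floc r : D r -> \forall s \near r, D s -> f s = f r.
  move=> Dr; have [[A1 rA1 hA1] [A2 rA2 hA2]] := (hP1 r Dr, hP2 r Dr).
  near=> s => Ds; have As1 : A1 s by near: s.
  have As2 : A2 s by near: s.
  have h1s := hA1 r s (conj Dr (nbhs_singleton rA1)) (conj Ds As1).
  have h2s := hA2 r s (conj Dr (nbhs_singleton rA2)) (conj Ds As2).
  by rewrite /f; lia.
(* Any condition on the locally constant [f] cuts out a relatively open set. Applied to [f r = f p]
   and to its negation, this gives a clopen part of [D]. *)
have fopen (k : int -> Prop) : exists2 C, open C & [set r | D r /\ k (f r)] = D `&` C.
  exists [set r | nbhs r [set s | D s -> k (f s)]].
    by rewrite openE => r; rewrite /interior /=; exact: nbhs_interior.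
  apply/seteqP; split=> r [Dr /= kr]; split=> //.
    by near=> s => Ds; rewrite (near (floc r Dr) s).
  exact: (nbhs_singleton kr).
have fclosed : exists2 C, closed C & [set r | D r /\ f r = f p] = D `&` C.
  have [C oC eC] := fopen (fun k => k <> f p).
  exists (~` C); first by rewrite closedC.
  apply/seteqP; split=> r /= [Dr kr]; split=> //.
    by move=> Cr; have : (D `&` C) r by []; rewrite -eC => -[].
  apply: contrapT => nk; apply: kr.
  by have : [set r | D r /\ f r <> f p] r by []; rewrite eC => -[].
have /(_ _)/seteqP[] := cD [set r | D r /\ f r = f p] _ (fopen (fun k => k = f p)) fclosed.
  by exists p.
by move=> _ /(_ q Dq)[].
Unshelve. all: by end_near. Qed.

Lemma loc_additivexx D p : loc_additive D -> D p -> e p p = 0.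
Proof.
move=> eD Dp; have [A /nbhs_singleton Ap eA] := eD p Dp.
by have := eA p p p (conj Dp Ap) (conj Dp Ap) (conj Dp Ap); lia.
Qed.

(** On the connected intersection the two primitives differ by a constant [k], by which [h2] is
    shifted. As the pieces are closed, a point outside one of them has a neighbourhood that meets
    only the other. *)
Lemma primitive_glue D1 D2 h1 h2 : closed D1 -> closed D2 ->
  connected (D1 `&` D2) -> loc_additive (D1 `|` D2) ->
  primitive D1 h1 -> primitive D2 h2 -> exists h, primitive (D1 `|` D2) h.
Proof.
move=> cD1 cD2 cD eD hP1 hP2.
have [k hk] : exists k, forall p, D1 p -> D2 p -> h2 p + k = h1 p.
  have [[p [D1p D2p]]|n0] := pselect (D1 `&` D2 !=set0); last first.
    by exists 0 => p D1p D2p; case: n0; exists p.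
  exists (h1 p - h2 p) => q D1q D2q.
  have := primitive_uniq cD (primitive_sub (@subIsetl _ _ _) hP1)
    (primitive_sub (@subIsetr _ _ _) hP2) (conj D1p D2p) (conj D1q D2q).
  by lia.
pose h q := if `[< D1 q >] then h1 q else h2 q + k.
have h1E q : D1 q -> h q = h1 q by move=> Dq; rewrite /h asboolT.
have h2E q : D2 q -> h q = h2 q + k.
  by rewrite /h; case: ifPn => // /asboolP D1q D2q; rewrite hk.
have far D p : closed D -> ~ D p -> nbhs p (~` D).
  by move=> cD' nDp; apply: open_nbhs_nbhs; split=> //; rewrite openC.
exists h => p Dp.
have [D1p|nD1p] := pselect (D1 p); last first.
  have D2p : D2 p by case: Dp.
  have [A pA hA] := hP2 p D2p; exists (A `&` ~` D1); first exact: filterI (far _ _ _ _).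
  move=> q r [Dq [Aq nq]] [Dr [Ar nr]].
  have [D2q D2r] : D2 q /\ D2 r by split; [case: Dq | case: Dr].
  by rewrite !h2E // (hA q r) //; lia.
have [D2p|nD2p] := pselect (D2 p); last first.
  have [A pA hA] := hP1 p D1p; exists (A `&` ~` D2); first exact: filterI (far _ _ _ _).
  move=> q r [Dq [Aq nq]] [Dr [Ar nr]].
  have [D1q D1r] : D1 q /\ D1 r by split; [case: Dq | case: Dr].
  by rewrite !h1E // (hA q r).
have [A1 pA1 hA1] := hP1 p D1p; have [A2 pA2 hA2] := hP2 p D2p.
have [A pA eA] := eD p Dp.
exists (A `&` (A1 `&` A2)); first by apply: filterI => //; exact: filterI.
have [Ap [A1p A2p]] := (nbhs_singleton pA, (nbhs_singleton pA1, nbhs_singleton pA2)).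
(* Near a common point [p], [q] and [r] may lie in different pieces. Each is compared with [p], and
   additivity of [e] combines the two jumps. *)
have hp q : (D1 `|` D2) q -> (A1 `&` A2) q -> e p q = h q - h p /\ e q p = h p - h q.
  move=> [] Dq [A1q A2q].
    by rewrite !h1E // (hA1 p q) // (hA1 q p).
  by rewrite !h2E // (hA2 p q) // (hA2 q p) //; lia.
move=> q r [Dq [Aq A12q]] [Dr [Ar A12r]]; rewrite -(eA q p r) //.
by have [_ ->] := hp q Dq A12q; have [-> _] := hp r Dr A12r; lia.
Qed.

End Primitive.

(** * Pulling jump functions and primitives back along a continuous map *)

Section Pullback.
Variables (S T : topologicalType) (phi : S -> T) (D : set S) (E : set T).
Hypotheses (phi_cont : {within D, continuous phi}) (phiDE : forall p, D p -> E (phi p)).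

Lemma loc_additive_pullback e :
  loc_additive e E -> loc_additive (fun p q => e (phi p) (phi q)) D.
Proof.
move=> eE p Dp; have [A pA eA] := eE _ (phiDE Dp).
have := (within_continuousP D phi).1 phi_cont p Dp A pA.
move=> pB; exists [set q | D q -> A (phi q)] => // q r s [Dq Aq] [Dr Ar] [Ds As].
by apply: eA; split; auto.
Qed.

Lemma primitive_pullback e h : primitive e E h ->
  primitive (fun p q => e (phi p) (phi q)) D (h \o phi).
Proof.
move=> hE p Dp; have [A pA hA] := hE _ (phiDE Dp).
have := (within_continuousP D phi).1 phi_cont p Dp A pA.
move=> pB; exists [set q | D q -> A (phi q)] => // q r [Dq Aq] [Dr Ar].
by apply: hA; split; auto.
Qed.

End Pullback.

Lemma eq_primitive (T : topologicalType) (D : set T) e e' h :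
  (forall p q, D p -> D q -> e p q = e' p q) -> primitive e D h -> primitive e' D h.
Proof.
move=> ee' hP p Dp; have [A pA hA] := hP p Dp; exists A => // q r Dq Dr.
by rewrite -ee' ?hA //; [case: Dq | case: Dr].
Qed.

(** Cousin's lemma, an induction over the interval: the supremum of the [s] with [P a s] satisfies
    [P] itself and cannot lie below [b]. It replaces a subdivision of the interval by a Lebesgue
    number. *)
Lemma cousin (R : realType) (P : R -> R -> Prop) (a b : R) : a <= b ->
  (forall x y z, a <= x -> x <= y -> y <= z -> z <= b -> P x y -> P y z -> P x z) ->
  (forall p, a <= p <= b -> exists2 d, 0 < d & forall x y, a <= x -> x <= p ->
     p <= y -> y <= b -> p - d < x -> y < p + d -> P x y) ->
  P a b.
Proof.
move=> ab Padd Ploc.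
pose S := [set s | a <= s <= b /\ P a s].
have Sa : S a.
  split; first by rewrite lexx ab.
  have [|d d0 aP] := Ploc a; first by rewrite lexx ab.
  by apply: aP; rewrite ?lexx // ?ltrBlDr ltrDl.
have ubS : ubound S b by move=> s [/andP[]].
have supS : has_sup S by split; [exists a | exists b].
have as_ : a <= sup S by apply: ub_le_sup => //; exists b.
have sb : sup S <= b by apply: ge_sup => //; exists a.
have [|d d0 dP] := Ploc (sup S); first by rewrite as_ sb.
have [s [/andP[a_s s_b] Pas] sd] := sup_adherent d0 supS.
have ss : s <= sup S by apply: ub_le_sup; [exists b | split=> //; rewrite a_s].
have reach t : sup S <= t -> t <= b -> t < sup S + d -> P a t.
  move=> st tb td; apply: (Padd a s t) => //; first exact: le_trans st.
  exact: dP.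
suff -> : b = sup S by apply: reach => //; rewrite ltrDl.
apply/eqP; rewrite eq_le sb andbT leNgt; apply/negP => sltb.
(* A point strictly beyond [sup S] but still within reach of the local hypothesis there. *)
pose t := Num.min b (sup S + d / 2).
have st : sup S < t by rewrite lt_min sltb ltrDl divr_gt0.
have tb : t <= b by rewrite ge_min lexx.
have : t <= sup S.
  apply: ub_le_sup; first by exists b.
  split; first by rewrite tb (le_trans as_ (ltW st)).
  apply: reach => //; first exact: ltW.
  by rewrite gt_min ltrD2l ltr_pdivrMr // ltr_pMr // ltr1n orbT.
by rewrite leNgt st.
Qed.

(** * Primitives on the square and on paths *)

Section SimplyConnected.
Variable R : realType.

Local Notation I := (`[0, 1]%classic : set R).

(** Two nested uses of [cousin]: rectangles are glued into a horizontal strip around each [y], then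
    strips are glued into the square. Neighbouring pieces meet in a segment, which is connected, so
    [primitive_glue] applies. *)
Lemma primitive_square (e : R * R -> R * R -> int) :
  loc_additive e (I `*` I) -> exists h, primitive e (I `*` I) h.
Proof.
move=> eI.
have cprod (A B : set R) : closed A -> closed B -> closed (A `*` B).
  move=> cA cB; have -> : A `*` B = fst @^-1` A `&` snd @^-1` B by [].
  by apply: closedI; apply: preimage_closed => // p _; [exact: cvg_fst | exact: cvg_snd].
have splitI (a b c : R) : a <= b -> b <= c ->
    `[a, c]%classic = `[a, b] `|` `[b, c] :> set R.
  move=> ab bc; apply/seteqP; split=> x /=; rewrite !in_itv /=.
    by move=> /andP[-> ->]; rewrite andbT; have [|/ltW] := leP x b; [left | right].
  by move=> [] /andP[h1 h2]; rewrite ?h1 ?h2 ?(le_trans h2) ?(le_trans ab).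
have capI (a b c : R) : a <= b -> b <= c -> `[a, b] `&` `[b, c] = [set b].
  move=> ab bc; apply/seteqP; split=> x /=; rewrite !in_itv /=.
    by move=> [/andP[_ xb] /andP[bx _]]; apply/eqP; rewrite eq_le xb.
  by move=> ->; rewrite !lexx ab.
have itvS (a b : R) : 0 <= a -> b <= 1 -> `[a, b] `<=` I.
  move=> a0 b1 x /=; rewrite !in_itv /= => /andP[ax xb].
  by rewrite (le_trans a0) ?(le_trans xb).
pose J (y d : R) : set R := `[y - d, y + d] `&` I.
have cJ y d : connected (J y d).
  apply/connected_intervalP => x z [x1 x2] [z1 z2] t xtz.
  split; [exact: (interval_is_interval x1 z1 xtz) | exact: (interval_is_interval x2 z2 xtz)].
have setXUl (A B C : set R) : (A `|` B) `*` C = (A `*` C) `|` (B `*` C).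
  by apply/seteqP; split=> [[x t] [/= [] ? ?]|[x t] [] [/= ? ?]];
    by [left | right | split; [left |] | split; [right |]].
have setXUr (A B C : set R) : A `*` (B `|` C) = (A `*` B) `|` (A `*` C).
  by apply/seteqP; split=> [[x t] [/= ? [] ?]|[x t] [] [/= ? ?]];
    by [left | right | split; [| left] | split; [| right]].
have setXIl (A B C : set R) : (A `&` B) `*` C = (A `*` C) `&` (B `*` C).
  by rewrite -setXI setIid.
have setXIr (A B C : set R) : A `*` (B `&` C) = (A `*` B) `&` (A `*` C).
  by rewrite -setXI setIid.
have clJ y d : closed (J y d) by apply: closedI; exact: itv_closed.
have JS y d d' : d <= d' -> J y d `<=` J y d'.
  move=> dd' x [/= xd xI]; split=> //=; move: xd; rewrite !in_itv /= => /andP[? ?].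
  by apply/andP; split; lra.
have strip y : I y -> exists2 d, 0 < d & exists h, primitive e (I `*` J y d) h.
  move=> Iy; pose P x x' := exists2 d, 0 < d &
    exists h, primitive e (`[x, x'] `*` J y d) h.
  apply: (@cousin _ P 0 1) => //.
    move=> x s x' x0 xs sx' x'1 [d1 d10 [h1 hP1]] [d2 d20 [h2 hP2]].
    (* The two rectangles may have different heights; the lower one serves for both. *)
    pose d := Num.min d1 d2; exists d; first by rewrite lt_min d10.
    have eqU : `[x, x'] `*` J y d = (`[x, s] `*` J y d) `|` (`[s, x'] `*` J y d).
      by rewrite (splitI _ s) // setXUl.
    rewrite eqU; apply: (@primitive_glue _ _ _ _ h1 h2).
    - by apply: cprod => //; exact: itv_closed.
    - by apply: cprod => //; exact: itv_closed.
    - have -> : (`[x, s] `*` J y d) `&` (`[s, x'] `*` J y d) = (fun t => (s, t)) @` J y d.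
        rewrite -setXIl capI //; apply/seteqP; split=> [[_ t] [/= -> Jt]|_ [t Jt <-]//].
        by exists t.
      apply: (connected_continuous_connected (cJ y d)).
      exact/continuous_subspaceT/pairl_continuous.
    - rewrite -eqU; apply: loc_additive_sub eI.
      by apply: setSX; [exact: subIsetr | exact: itvS].
    - by apply: primitive_sub hP1; apply: setSX => //; apply: JS; rewrite ge_min lexx.
    - apply: primitive_sub hP2; apply: setSX => //; apply: JS.
      by rewrite ge_min lexx orbT.
  move=> s sI; have [A [/= [B C] [/= sB yC] BCA] eA] := eI (s, y) (conj sI Iy).
  have [d1 /= d10 d1B] := (nbhs_ballP _ _).1 sB.
  have [d2 /= d20 d2C] := (nbhs_ballP _ _).1 yC.
  (* [J] uses a closed interval, so half of [d2] keeps it inside the open ball. *)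
  exists d1 => // x x' x0 xs sx' x'1 sdx xsd; exists (d2 / 2); first by rewrite divr_gt0.
  exists (e (s, y)); apply: additive_primitive.
    split=> /=; first by rewrite in_itv /= xs.
    by split=> //=; rewrite in_itv /=; apply/andP; split; lra.
  move=> p q r; have sub : `[x, x'] `*` J y (d2 / 2) `<=` (I `*` I) `&` A.
    move=> [u v] [/= ux [/= vy vI]]; split; first by split=> //; exact: (itvS _ _ _ _ _ ux).
    apply: BCA; split=> /=.
      apply: d1B; rewrite /ball /= ltr_norml; move: ux; rewrite in_itv /= => /andP[? ?].
      by apply/andP; split; lra.
    apply: d2C; rewrite /ball /= ltr_norml; move: vy; rewrite in_itv /= => /andP[? ?].
    by apply/andP; split; lra.
  by move=> /sub ? /sub ? /sub ?; exact: eA.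
apply: (@cousin _ (fun y y' => exists h, primitive e (I `*` `[y, y']) h) 0 1) => //.
  move=> x s x' x0 xs sx' x'1 [h1 hP1] [h2 hP2].
  rewrite (splitI _ s) // setXUr; apply: (@primitive_glue _ _ _ _ h1 h2) => //.
  - by apply: cprod; exact: itv_closed.
  - by apply: cprod; exact: itv_closed.
  - rewrite -setXIr capI //.
    have -> : I `*` [set s] = (fun t => (t, s)) @` I.
      by apply/seteqP; split=> [[t _] [/= It ->]|_ [t It <-]//]; exists t.
    apply: connected_continuous_connected.
      by apply/connected_intervalP; exact: interval_is_interval.
    by exact/continuous_subspaceT/pairr_continuous.
  - by rewrite -setXUr -splitI //; apply: loc_additive_sub eI; apply: setSX => //; exact: itvS.
move=> y yI; have [d d0 [h hP]] := strip y yI; exists d => // x x' x0 xy yx' x'1 ydx xyd.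
exists h; apply: primitive_sub hP; apply: setSX => // t tx; split; last exact: itvS tx.
by move: tx; rewrite /= !in_itv /= => /andP[? ?]; apply/andP; split; lra.
Qed.


Lemma affine_continuous (a b : R) : continuous (fun t : R => a * t + b : R).
Proof.
move=> t; apply: continuousD; last exact: cst_continuous.
by apply: continuousM; [exact: cst_continuous | exact: cvg_id].
Qed.

Lemma primitive_segment (e : R -> R -> int) :
  loc_additive e I -> exists h, primitive e I h.
Proof.
move=> eI; have [|h hP] := @primitive_square (fun p q => e p.1 q.1).
  apply: (@loc_additive_pullback _ _ fst _ I) eI; last by move=> p [].
  by apply: continuous_subspaceT => p; exact: cvg_fst.
have I0 : I 0 by rewrite /= in_itv /= lexx ler01.
exists (h \o (fun t => (t, 0))).
by have := primitive_pullback (phi := fun t : R => (t, 0 : R)) (D := I)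
  (continuous_subspaceT (@pairr_continuous R R 0)) (fun t It => conj It I0) hP.
Qed.

(* The redundant [+ 0] makes both pieces instances of [affine_continuous]. *)
Definition path_cat (T : Type) (p q : R -> T) (t : R) : T :=
  if t <= 2^-1 then p (2 * t + 0) else q (2 * t + -1).

Lemma path_cat_left (T : Type) (p q : R -> T) t :
  t <= 2^-1 -> path_cat p q t = p (2 * t + 0).
Proof. by rewrite /path_cat => ->. Qed.

Lemma path_cat_right (T : Type) (p q : R -> T) t :
  p 1 = q 0 -> 2^-1 <= t -> path_cat p q t = q (2 * t + -1).
Proof.
move=> pq t2; rewrite /path_cat; case: ifPn => // t2'.
have -> : t = 2^-1 by apply/eqP; rewrite eq_le t2'.
by rewrite addr0 mulfV // subrr.
Qed.

Lemma path_cat0 (T : Type) (p q : R -> T) : path_cat p q 0 = p 0.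
Proof. by rewrite path_cat_left ?invr_ge0 // mulr0 addr0. Qed.

Lemma path_cat1 (T : Type) (p q : R -> T) : p 1 = q 0 -> path_cat p q 1 = q 1.
Proof.
move=> /path_cat_right ->; last by rewrite invf_le1 ?ler1n.
by congr q; rewrite mulr1; apply/eqP; rewrite subr_eq.
Qed.

Lemma path_cat_continuous (T : topologicalType) (p q : R -> T) :
  {within I, continuous p} -> {within I, continuous q} -> p 1 = q 0 ->
  {within I, continuous (path_cat p q)}.
Proof.
move=> pC qC pq.
have -> : I = `[0, 2^-1] `|` `[2^-1, 1].
  apply/seteqP; split=> x /=; rewrite !in_itv /=.
    move=> /andP[-> ->]; rewrite andbT; have [|/ltW] := leP x 2^-1; by [left | right].
  by move=> [] /andP[? ?]; apply/andP; split; lra.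
apply: withinU_continuous; [exact: itv_closed | exact: itv_closed | |].
- apply: (@subspace_eq_continuous _ _ _ (p \o (fun t => 2 * t + 0))).
    move=> t /set_mem /=; rewrite in_itv /= => /andP[_ t2].
    by rewrite /from_subspace path_cat_left.
  apply: within_comp pC; first exact/continuous_subspaceT/affine_continuous.
  by move=> t /=; rewrite !in_itv /= => /andP[? ?]; apply/andP; split; lra.
- apply: (@subspace_eq_continuous _ _ _ (q \o (fun t => 2 * t + -1))).
    move=> t /set_mem /=; rewrite in_itv /= => /andP[t2 _].
    by rewrite /from_subspace path_cat_right.
  apply: within_comp qC; first exact/continuous_subspaceT/affine_continuous.
  by move=> t /=; rewrite !in_itv /= => /andP[? ?]; apply/andP; split; lra.
Qed.

(** * A global potential on a simply connected space *)

Section Potential.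
Variables (X : topologicalType) (e : X -> X -> int).
Hypothesis eX : loc_additive e setT.

Local Notation along g := (fun s t => e (g s) (g t)).

Lemma primitive_path (g : R -> X) : {within I, continuous g} ->
  exists h, primitive (along g) I h.
Proof.
by move=> gC; apply: primitive_segment; exact: (loc_additive_pullback gC) eX.
Qed.

(** Increments do not depend on the parametrisation. This serves for the two halves of a
    concatenation and, with [a = -1] and [b = 1], for the reversed path. *)
Lemma primitive_affine (g : R -> X) (k : R -> X) h l (a b : R) :
  {within I, continuous g} ->
  (forall t, I t -> I (a * t + b) /\ g (a * t + b) = k t) ->
  primitive (along g) I h -> primitive (along k) I l ->
  l 1 - l 0 = h (a + b) - h b.
Proof.
move=> gC gk hP lP.
have I0 : I 0 by rewrite /= in_itv /= lexx ler01.
have I1 : I 1 by rewrite /= in_itv /= lexx ler01.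
have cI : connected I by apply/connected_intervalP; exact: interval_is_interval.
have phiI : {within I, continuous (fun t => a * t + b)}.
  exact/continuous_subspaceT/affine_continuous.
have := primitive_pullback phiI (fun t It => (gk t It).1) hP.
have kg s t : I s -> I t -> e (g (a * s + b)) (g (a * t + b)) = e (k s) (k t).
  by move=> Is It; rewrite (gk s Is).2 (gk t It).2.
move=> /(eq_primitive kg) hP'.
by rewrite (primitive_uniq cI lP hP' I0 I1) /= mulr0 mulr1 add0r.
Qed.

(** The null homotopy pulls [e] back to the square, where a primitive [k] exists. Each of the three
    sides sent to [g 0] has equal values of [k] at its ends, hence so does the bottom side, along
    which the homotopy is [g]. *)
Lemma primitive_loop (g : R -> X) h : simply_connected R X ->
  {within I, continuous g} -> g 0 = g 1 -> primitive (along g) I h -> h 1 = h 0.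
Proof.
move=> [_ sX] gC g01 hP; have [H [HC Hbot Htop Hside]] := sX g gC g01.
have I0 : I 0 by rewrite /= in_itv /= lexx ler01.
have I1 : I 1 by rewrite /= in_itv /= lexx ler01.
have cI : connected I by apply/connected_intervalP; exact: interval_is_interval.
have [k kP] : exists k, primitive (fun p q => e (H p) (H q)) (I `*` I) k.
  apply: primitive_square; apply: loc_additive_pullback eX => //.
have e0 : primitive (fun _ _ : R => e (g 0) (g 0)) I (fun=> 0).
  by move=> t It; exists setT; [exact: filterT | rewrite (loc_additivexx eX)].
have edge (phi : R -> R * R) : continuous phi -> (forall t, I t -> (I `*` I) (phi t)) ->
    (forall t, I t -> H (phi t) = g 0) -> k (phi 0) = k (phi 1).
  move=> phiC phiI Hphi.
  have kphi := primitive_pullback (continuous_subspaceT phiC) phiI kP.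
  have ee s t : I s -> I t -> e (H (phi s)) (H (phi t)) = e (g 0) (g 0).
    by move=> Is It; rewrite !Hphi.
  have := primitive_uniq cI (eq_primitive ee kphi) e0 I0 I1.
  by rewrite /= subrr => /eqP; rewrite subr_eq0 => /eqP.
have left_ : k (0, 0) = k (0, 1).
  by apply: (edge (fun t => (0, t))) => [|t It|t /Hside[]//]; [exact: pairl_continuous |].
have right_ : k (1, 0) = k (1, 1).
  by apply: (edge (fun t => (1, t))) => [|t It|t /Hside[]//]; [exact: pairl_continuous |].
have top_ : k (0, 1) = k (1, 1).
  by apply: (edge (fun t => (t, 1))) => [|t It|t /Htop]//; exact: pairr_continuous.
have kbot := primitive_pullback (phi := fun t : R => (t, 0 : R)) (D := I)
  (continuous_subspaceT (@pairr_continuous R R 0)) (fun t It => conj It I0) kP.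
have ee s t : I s -> I t -> e (H (s, 0)) (H (t, 0)) = e (g s) (g t).
  by move=> Is It; rewrite !Hbot.
have /eqP := primitive_uniq cI hP (eq_primitive ee kbot) I0 I1.
by rewrite /= right_ -top_ -left_ subrr subr_eq0 => /eqP.
Qed.

Lemma primitive_cat (p q : R -> X) hp hq h : {within I, continuous p} ->
  {within I, continuous q} -> p 1 = q 0 -> primitive (along p) I hp ->
  primitive (along q) I hq -> primitive (along (path_cat p q)) I h ->
  h 1 - h 0 = (hp 1 - hp 0) + (hq 1 - hq 0).
Proof.
have arith (t : R) : I t -> [/\ I (2^-1 * t + 0), I (2^-1 * t + 2^-1),
    2^-1 * t + 0 <= 2^-1 & 2^-1 <= 2^-1 * t + 2^-1].
  rewrite /= !in_itv /= => /andP[? ?].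
  by split; [apply/andP; split| apply/andP; split| |]; lra.
have arith1 (t : R) : 2 * (2^-1 * t + 0) + 0 = t by field.
have arith2 (t : R) : 2 * (2^-1 * t + 2^-1) + -1 = t by field.
have arith3 : 2^-1 + 2^-1 = 1 :> R by field.
move=> pC qC pq hpP hqP hP; have catC := path_cat_continuous pC qC pq.
rewrite (@primitive_affine _ _ _ _ 2^-1 0 catC _ hP hpP); last first.
  by move=> t /arith[? ? ? ?]; split=> //; rewrite path_cat_left // arith1.
rewrite (@primitive_affine _ _ _ _ 2^-1 2^-1 catC _ hP hqP); last first.
  by move=> t /arith[? ? ? ?]; split=> //; rewrite path_cat_right // arith2.
by rewrite arith3 addr0; lia.
Qed.

(** [M x] is the increment along a chosen path from [x0] to [x]. The chosen path to [g 0], then [g],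
    then the reversed chosen path to [g 1] form a loop, whose increment vanishes. *)
Lemma simply_connected_potential (x0 : X) : simply_connected R X ->
  exists M : X -> int, forall g h, {within I, continuous g} ->
    primitive (along g) I h -> h 1 - h 0 = M (g 1) - M (g 0).
Proof.
have revI (t : R) : I t -> I (-1 * t + 1).
  by rewrite /= !in_itv /= => /andP[? ?]; apply/andP; split; lra.
have revK (t : R) : -1 * (-1 * t + 1) + 1 = t by ring.
move=> sX; have [pX _] := sX.
have hol x : exists m, exists g h, [/\ {within I, continuous g}, g 0 = x0, g 1 = x,
    primitive (along g) I h & m = h 1 - h 0].
  have [g [gC g0 g1]] := pX x0 x; have [h hP] := primitive_path gC.
  by exists (h 1 - h 0), g, h.
have [M MP] := choice hol; exists M => g h gC hP.
have [g0 [h0 [g0C g00 g01 h0P ->]]] := MP (g 0).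
have [g1 [h1 [g1C g10 g11 h1P ->]]] := MP (g 1).
pose g1r (t : R) := g1 (-1 * t + 1).
have g1rC : {within I, continuous g1r}.
  by apply: within_comp revI g1C; exact/continuous_subspaceT/affine_continuous.
have g1r0 : g 1 = g1r 0 by rewrite /g1r mulr0 add0r.
have g1r1 : g1r 1 = x0 by rewrite /g1r mulr1 addNr.
have [h1r h1rP] := primitive_path g1rC.
have h1E : h1 1 - h1 0 = h1r 0 - h1r 1.
  rewrite (@primitive_affine _ _ _ _ (-1) 1 g1rC _ h1rP h1P) ?addNr // => t It.
  by split; [exact: revI | rewrite /g1r revK].
pose L1 := path_cat g g1r; pose L := path_cat g0 L1.
have L1C : {within I, continuous L1} by exact: path_cat_continuous.
have L10 : g0 1 = L1 0 by rewrite /L1 path_cat0.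
have LC : {within I, continuous L} by exact: path_cat_continuous.
have [l1 l1P] := primitive_path L1C; have [l lP] := primitive_path LC.
have L01 : L 0 = L 1 by rewrite /L path_cat0 path_cat1 // /L1 path_cat1 // g1r1.
have l01 := primitive_loop sX LC L01 lP.
have := primitive_cat g0C L1C L10 h0P l1P lP.
have := primitive_cat gC g1rC g1r0 hP h1rP l1P.
by rewrite h1E l01; lia.
Qed.

(** Along a path inside a set where [e] is additive, [e (g 0)] is itself a primitive, so the
    increment is the single jump between the end points. *)
Lemma simply_connected_cocycle (x0 : X) : simply_connected R X ->
  exists M : X -> int, forall (o : set X) (g : R -> X), additive_on e o ->
    {within I, continuous g} -> (forall t, I t -> o (g t)) ->
    M (g 1) - M (g 0) = e (g 0) (g 1).
Proof.
move=> sX; have [M MP] := simply_connected_potential x0 sX.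
exists M => o g eo gC go.
have I0 : I 0 by rewrite /= in_itv /= lexx ler01.
have I1 : I 1 by rewrite /= in_itv /= lexx ler01.
rewrite -(MP g (e (g 0) \o g) gC) /=.
  by have := eo _ _ _ (go 0 I0) (go 0 I0) (go 1 I1); lia.
apply: (@primitive_pullback _ _ g I o gC go e (e (g 0))).
exact: additive_primitive (go 0 I0) eo.
Qed.

End Potential.

End SimplyConnected.

(** * Slowly oscillating functions *)

Section Tame.
Context {R : realType} {X : metricType R} (x0 : X).
Implicit Types f g : X -> R^o.

Lemma in_ballE (x y : X) (r : R) : ball x r y <-> mdist x y < r.
Proof. by rewrite ballEmdist. Qed.

Definition far_flat f : Prop :=
  forall r e : R, 0 < r -> 0 < e -> exists M : R, forall x : X, M < mdist x x0 ->
    forall y z, ball x r y -> ball x r z -> `|f y - f z| < e.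

Lemma slowly_oscillatingP f : slowly_oscillating x0 f <-> far_flat f.
Proof.
split=> fP r; last first.
  move=> r0 e e0; have [M MP] := fP r (e / 2) r0 (divr_gt0 e0 (ltr0n _ 2)).
  exists M => x /MP xP; apply: (@le_lt_trans _ _ (e / 2)%:E); last first.
    by rewrite lte_fin; lra.
  apply: ge_ereal_sup => _ [[_ _] /= [[y xy <-] [z xz <-]] <-].
  by rewrite lee_fin ltW // /mdist /=; exact: xP.
move=> e r0 e0; have [M MP] := fP r r0 e e0.
exists M => x /MP xP y z xy xz; rewrite -lte_fin; apply: le_lt_trans xP.
apply: ereal_sup_ubound; exists (f z, f y) => //=.
by split; [exists z | exists y].
Qed.

(** Membership in [higson_functions] without boundedness, so that the unbounded lift of a cocycle is
    covered. *)
Definition tame f : Prop := continuous f /\ far_flat f.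

Lemma tame_higson f (K : R) : (forall x, `|f x| <= K) -> tame f ->
  higson_functions x0 f.
Proof.
move=> fK [cf ff]; split=> //; last exact/slowly_oscillatingP.
by exists K; split=> [|t Kt x _]; [exact: num_real | apply: le_trans (fK x) (ltW Kt)].
Qed.

Lemma higson_bounded f : higson_functions x0 f -> exists K, forall x, `|f x| <= K.
Proof.
move=> [[K [_ fK]] _ _]; exists (K + 1) => x.
by apply: fK => //; rewrite ltrDl.
Qed.

Lemma higson_tame f : higson_functions x0 f -> tame f.
Proof. by move=> [_ cf /slowly_oscillatingP]. Qed.

(* The estimate is only required on balls on which some [f i] is controlled from
   below: this is what makes the lemma apply to the lift of a circle-valued map. *)
Lemma tame_local (I : finType) (f : I -> X -> R^o) g (C : R) : 0 <= C ->
  (forall i, tame (f i)) ->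
  (forall x, exists i, 1 < f i x) ->
  (forall i x r, 0 < r -> (forall y, ball x r y -> 0 < f i y) ->
     forall y z, ball x r y -> ball x r z ->
     `|g y - g z| <= C * \sum_k `|f k y - f k z|) ->
  tame g.
Proof.
move=> C0 tf f1 gf.
have small e : 0 < e -> exists d, [/\ 0 < d, d <= 1 & forall y z,
    (forall i, `|f i y - f i z| < d) -> C * (\sum_k `|f k y - f k z|) < e].
  move=> e0; pose K := C * #|I|%:R; have K0 : 0 <= K by rewrite mulr_ge0.
  have K10 : 0 < K + 1 by lra.
  (* The bound [1] turns [1 < f i x] into positivity of [f i] on the whole ball; [K + 1] is positive
     even if [K] is zero. *)
  exists (Num.min 1 (e / (K + 1))); split.
  - by rewrite lt_min ltr01 divr_gt0.
  - by rewrite ge_min lexx.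
  move=> y z yz; apply: (@le_lt_trans _ _ (K * (e / (K + 1)))).
    rewrite /K -mulrA ler_wpM2l // [#|I|%:R * _]mulr_natl -sumr_const.
    by apply: ler_sum => i _; rewrite ltW //; have := yz i; rewrite lt_min => /andP[].
  by rewrite mulrCA gtr_pMr // ltr_pdivrMr //; lra.
split.
  move=> x; have [i fi1] := f1 x; apply/cvgrPdist_lt => e e0.
  have [d [d0 d1 dP]] := small e e0.
  have : \forall y \near x, forall k, `|f k x - f k y| < d.
    by apply: filter_forall => k; move: ((tf k).1 x) => /cvgrPdist_lt; exact.
  move=> /nbhs_ballP[r /= r0 rP]; near=> y.
  have xy : ball x r y by near: y; exact: nbhsx_ballx.
  apply: le_lt_trans (dP x y (rP y xy)).
  apply: (gf i x r) => //; last exact: ballxx.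
  by move=> t /rP /(_ i); rewrite ltr_norml => /andP[? ?]; lra.
move=> r e r0 e0; have [d [d0 d1 dP]] := small e e0.
have [M MP] := choice (fun i => (tf i).2 r d r0 d0).
exists (\sum_i `|M i|) => x xM; have [i fi1] := f1 x.
have {}MP k : forall y z, ball x r y -> ball x r z -> `|f k y - f k z| < d.
  apply: MP; apply: le_lt_trans xM; rewrite (bigD1 k) //=.
  by apply: le_trans (ler_norm _) _; rewrite lerDl sumr_ge0.
move=> y z xy xz; apply: le_lt_trans (dP y z (fun k => MP k y z xy xz)).
apply: (gf i x r) => // t xt.
by have := MP i x t (ballxx _ r0) xt; rewrite ltr_norml => /andP[? ?]; lra.
Unshelve. all: by end_near. Qed.

Lemma tame_cst (c : R) : tame (cst c).
Proof.
split; first exact: cst_continuous.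
by move=> r e r0 e0; exists 0 => *; rewrite /cst subrr normr0.
Qed.

Lemma tame_dom (I : finType) (f : I -> X -> R^o) g (C : R) : 0 <= C ->
  (forall i, tame (f i)) ->
  (forall y z, `|g y - g z| <= C * \sum_k `|f k y - f k z|) -> tame g.
Proof.
move=> C0 tf gf; apply: (@tame_local _ (fun o => if o is Some i then f i else cst 2) g C C0).
- by case=> [i|]; [exact: tf | exact: tame_cst].
- by move=> x; exists None; rewrite /cst ltr1n.
- move=> _ x r _ _ y z _ _; rewrite (bigD1 None) //= subrr normr0 add0r.
  rewrite (reindex_omap Some id) /=; last by case.
  by rewrite (eq_bigl xpredT) // => i; rewrite eqxx.
Qed.

Lemma tame_dom1 f g (C : R) : 0 <= C -> tame f ->
  (forall y z, `|g y - g z| <= C * `|f y - f z|) -> tame g.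
Proof.
move=> C0 tf gf; apply: (@tame_dom unit (fun=> f) g C C0) => // y z.
by rewrite big_const card_unit /= addr0.
Qed.

Lemma tame_dom2 f1 f2 g (C : R) : 0 <= C -> tame f1 -> tame f2 ->
  (forall y z, `|g y - g z| <= C * (`|f1 y - f1 z| + `|f2 y - f2 z|)) -> tame g.
Proof.
move=> C0 tf1 tf2 gf; apply: (@tame_dom bool (fun b => if b then f1 else f2) g C C0).
  by case.
by move=> y z; rewrite big_bool /=.
Qed.

End Tame.

(** * The Higson compactification *)

Lemma ler_norm_min (R : realDomainType) (a b : R) : `|Num.min a b| <= `|a| + `|b|.
Proof. by case: (leP a b) => _; rewrite ?lerDl ?lerDr. Qed.

Lemma ler_dist_min (R : realDomainType) (a b c d : R) :
  `|Num.min a b - Num.min c d| <= `|a - c| + `|b - d|.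
Proof.
have := ler_norm (a - c); have := ler_norm (b - d).
have := ler_norm (- (a - c)); have := ler_norm (- (b - d)); rewrite !normrN.
move: `|a - c| `|b - d| (normr_ge0 (a - c)) (normr_ge0 (b - d)) => p q p0 q0 *.
rewrite ler_norml; apply/andP; split.
  by case: (leP a b) => ?; case: (leP c d) => ?; lra.
by case: (leP a b) => ?; case: (leP c d) => ?; lra.
Qed.

Lemma tent_continuous (R : realType) (T : topologicalType) (u : T -> R) (a b c : R) :
  continuous u -> continuous (fun w => a - b * `|u w - c|).
Proof.
move=> uC w; apply: cvgB; first exact: cvg_cst.
apply: cvgM; first exact: cvg_cst.
by apply: cvg_norm; apply: cvgB; [exact: uC | exact: cvg_cst].
Qed.

(** * Extensions of functions, compactness and a base of the topology *)

Section HigsonEval.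
Context {R : realType} {X : metricType R} (x0 : X).

Definition higson_fun f (fP : higson_functions x0 f) : higson_functions x0 :=
  exist _ f (mem_set fP).

(* The continuous extension of [f] to the compactification is its coordinate. *)
Definition higson_eval (f : higson_functions x0) (z : higson x0) : R :=
  set_val (set_val z f).

Definition to_higson (x : X) : higson x0 :=
  exist _ (@higson_embedding R X x0 x)
    (mem_set (subset_closure (ex_intro2 _ _ x I erefl))).

Lemma proj_cube_continuous (f : higson_functions x0) :
  continuous (fun p : higson_cube x0 => p f).
Proof. exact: (@proj_continuous _ (@higson_interval R X x0) f). Qed.

Lemma higson_eval_continuous f : continuous (higson_eval f).
Proof.
move=> z; apply: (@continuous_comp _ _ _ (fun z : higson x0 => set_val z f) set_val).
  apply: (@continuous_comp _ _ _ (set_val : higson x0 -> higson_cube x0) (fun p => p f)).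
    exact: initial_continuous.
  exact: proj_cube_continuous.
exact: initial_continuous.
Qed.

Lemma to_higson_dense (u : set (higson x0)) : open u -> u !=set0 ->
  exists x, u (to_higson x).
Proof.
move=> [V oV <-] [z Vz].
have [_ [[x _ <-] Vx]] : range (@higson_embedding R X x0) `&` V !=set0.
  by apply: (set_mem (valP z)); exact: open_nbhs_nbhs.
by exists x.
Qed.

(** By density of [X]. It serves to compute the extension of a function built by a formula from
    other functions. *)
Lemma eq_on_higson (u v : higson x0 -> R) : continuous u -> continuous v ->
  (forall x, u (to_higson x) = v (to_higson x)) -> u =1 v.
Proof.
move=> uC vC uv z; apply: contrapT => /eqP nuv.
have [x] : exists x, [set w | u w - v w != 0] (to_higson x).
  apply: to_higson_dense; last by exists z; rewrite /= subr_eq0.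
  apply: (@open_comp _ _ (fun w => u w - v w) [set t | t != 0]); last exact: open_neq.
  by move=> w _; apply: continuousB; [exact: uC | exact: vC].
by rewrite /= uv subrr eqxx.
Qed.

Lemma compact_set_type (T : topologicalType) (A : set T) :
  compact A -> compact [set: set_type A].
Proof.
move=> cA F FF _; pose G := (set_val : set_type A -> T) @ F.
have GA : F (set_val @^-1` A).
  by apply: (filterS _ (@filterT _ F _)) => -[a Aa] _; exact: (set_mem Aa).
have [a [Aa aG]] := cA G _ GA.
exists (exist _ a (mem_set Aa)); split=> // B C FB [_ [[V oV <-] /= Va] VC].
have GB : F (set_val @^-1` (set_val @` B)) by apply: (filterS _ FB) => b; exists b.
have [_ [[b Bb <-] Vb]] := aG _ V GB (open_nbhs_nbhs (conj oV Va)).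
by exists b; split=> //; exact: VC.
Qed.

Lemma higson_compact : compact [set: higson x0].
Proof.
apply/compact_set_type/(subclosed_compact (@closed_closure _ _)); last exact: subsetT.
pose S : set (higson_cube x0) := [set f | forall i, [set: higson_interval i] (f i)].
have -> : [set: higson_cube x0] = S by apply/seteqP; split.
apply: (@tychonoff _ (@higson_interval R X x0) (fun=> setT)) => f.
apply: compact_set_type; exact: segment_compact.
Qed.

Lemma higson_base (z : higson x0) u : open u -> u z ->
  exists f : higson_functions x0, 1 < higson_eval f z /\
    forall w, 0 < higson_eval f w -> u w.
Proof.
move=> [V oV <-] Vz.
(* The sets for which the claim holds form a filter, with minima of functions for intersections. It
   converges to [z] once it contains the neighbourhoods given by a single coordinate. *)
pose F : set_system (higson_cube x0) := [set B | exists f : higson_functions x0,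
  1 < higson_eval f z /\ forall w, 0 < higson_eval f w -> B (set_val w)].
have FF : Filter F.
  split.
  - have cK (x : X) : `|cst (2 : R) x| <= 2 by rewrite ger0_norm.
    exists (higson_fun (tame_higson cK (tame_cst _ _))); split=> //.
    rewrite (@eq_on_higson _ (cst 2)) ?ltr1n //; first exact: higson_eval_continuous.
    exact: cst_continuous.
  - move=> A B [f [fz fA]] [g [gz gB]].
    pose h x := Num.min (set_val f x) (set_val g x).
    have [fH gH] := (set_mem (valP f), set_mem (valP g)).
    have [[K1 fK1] [K2 gK2]] := (higson_bounded fH, higson_bounded gH).
    have hH : higson_functions x0 h.
      apply: (@tame_higson _ _ _ _ (K1 + K2)) => [x|].
        apply: le_trans (ler_norm_min _ _) _.
        exact: lerD (fK1 x) (gK2 x).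
      apply: (@tame_dom2 _ _ _ _ _ h 1 _ (higson_tame fH) (higson_tame gH)) => // x y.
      by rewrite mul1r; exact: ler_dist_min.
    have hE w : higson_eval (higson_fun hH) w = Num.min (higson_eval f w) (higson_eval g w).
      move: w; apply: eq_on_higson => //; first exact: higson_eval_continuous.
      by move=> w; apply: continuous_min; exact: higson_eval_continuous.
    exists (higson_fun hH); rewrite hE lt_min fz gz; split=> // w.
    by rewrite hE lt_min => /andP[/fA ? /gB ?].
  - by move=> A B AB [f [fz fA]]; exists f; split=> // w /fA/AB.
suff FO : F --> (set_val z : higson_cube x0).
  by apply: FO; exact: open_nbhs_nbhs.
apply/cvg_sup => g A [_ [[B [C oC <-] <-] /= Cz] BA].
have [e /= e0 eC] := (nbhs_ballP _ _).1 (open_nbhs_nbhs (conj oC Cz)).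
pose c := higson_eval g z.
(* A tent of height [2], positive exactly where [g] is within [e] of [c]. *)
pose h x := 2 - 2 / e * `|set_val g x - c|.
have gH := set_mem (valP g); have [K gK] := higson_bounded gH.
have C0 : 0 <= 2 / e by rewrite divr_ge0 // ltW.
have hH : higson_functions x0 h.
  apply: (@tame_higson _ _ _ _ (2 + 2 / e * (K + `|c|))) => [x|].
    have u0 : 0 <= 2 / e * `|set_val g x - c| by rewrite mulr_ge0.
    apply: le_trans (ler_normB _ _) _; rewrite (ger0_norm u0) ger0_norm // lerD2l.
    by rewrite ler_wpM2l //; apply: le_trans (ler_normB _ _) _; rewrite lerD2r; exact: gK.
  apply: (@tame_dom1 _ _ _ _ h _ C0 (higson_tame gH)) => x y.
  rewrite /h opprB addrC addrA subrK -mulrBr normrM (ger0_norm C0) ler_wpM2l //.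
  apply: le_trans (ler_dist_dist _ _) _.
  by rewrite opprB addrA subrK distrC.
have hE w : higson_eval (higson_fun hH) w = 2 - 2 / e * `|higson_eval g w - c|.
  move: w; apply: eq_on_higson => //; first exact: higson_eval_continuous.
  exact/tent_continuous/higson_eval_continuous.
exists (higson_fun hH); rewrite hE subrr normr0 mulr0 subr0 ltr1n; split=> // w.
rewrite hE subr_gt0 => wc; apply: BA; apply: eC => /=.
rewrite /ball /= distrC; move: wc; rewrite mulrAC -mulrA gtr_pMr // ltr_pdivrMr //.
by rewrite mul1r.
Qed.

End HigsonEval.

(** * Lifting a cocycle *)

Section DistMod.
Variables (R : realType) (n : nat).
Hypothesis n0 : (0 < n)%N.

(** The distance from [t] to the subgroup generated by [n], as the smaller of the distances to the
    two multiples around [t]. *)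
Definition dist_mod (t : R) : R :=
  let k := Num.floor (t / n%:R) in
  Num.min (t - n%:R * k%:~R) (n%:R * (k + 1)%:~R - t).

Let nR0 : 0 < n%:R :> R. Proof. by rewrite ltr0n. Qed.

Let floorP (t : R) : n%:R * (Num.floor (t / n%:R))%:~R <= t <
  n%:R * (Num.floor (t / n%:R) + 1)%:~R.
Proof.
by have := floor_itv (t / n%:R); rewrite ler_pdivlMr // ltr_pdivrMr // ![_%:~R * _]mulrC.
Qed.

Lemma dist_mod_attained t : exists k : int, dist_mod t = `|t - n%:R * k%:~R|.
Proof.
have /andP[tl tr] := floorP t; rewrite /dist_mod; case: leP => _.
  by exists (Num.floor (t / n%:R)); rewrite ger0_norm // subr_ge0.
by exists (Num.floor (t / n%:R) + 1); rewrite distrC ger0_norm // subr_ge0 ltW.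
Qed.

Lemma dist_mod_le t (k : int) : dist_mod t <= `|t - n%:R * k%:~R|.
Proof.
have /andP[tl tr] := floorP t; rewrite /dist_mod ge_min.
have [kl|kr] := leP k (Num.floor (t / n%:R)).
  have h : n%:R * k%:~R <= n%:R * (Num.floor (t / n%:R))%:~R :> R.
    by rewrite ler_pM2l // ler_int.
  by rewrite ger0_norm ?lerD2l ?lerN2 ?h // subr_ge0 (le_trans h).
have h : n%:R * (Num.floor (t / n%:R) + 1)%:~R <= n%:R * k%:~R :> R.
  by rewrite ler_pM2l // ler_int lezD1.
apply/orP; right; rewrite distrC ger0_norm ?lerD2r //.
by rewrite subr_ge0 (le_trans (ltW tr)).
Qed.

Lemma dist_mod_bounded t : `|dist_mod t| <= n%:R.
Proof.
have [k tk] := dist_mod_attained t; rewrite ger0_norm ?tk // -tk.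
have /andP[tl tr] := floorP t.
apply: le_trans (dist_mod_le t (Num.floor (t / n%:R))) _.
move: tr; rewrite ger0_norm ?subr_ge0 // intrD mulrDr mulr1; lra.
Qed.

Lemma dist_mod_lipschitz s t : `|dist_mod s - dist_mod t| <= `|s - t|.
Proof.
wlog st : s t / dist_mod t <= dist_mod s.
  by move=> h; have [/h//|/ltW/h] := leP (dist_mod t) (dist_mod s); rewrite distrC (distrC t).
have [k tk] := dist_mod_attained t.
rewrite ger0_norm ?subr_ge0 // lerBlDr tk.
by apply: le_trans (dist_mod_le s k) _; rewrite -{1}(subrK t s) -addrA ler_normD.
Qed.

Lemma dist_mod0 (k : int) : dist_mod (n%:R * k%:~R) = 0.
Proof.
have := dist_mod_le (n%:R * k%:~R) k; rewrite subrr normr0.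
have [k' ->] := dist_mod_attained (n%:R * k%:~R).
by rewrite normr_le0 => /eqP ->; rewrite normr0.
Qed.

(** At an integer the distance is an integer, so it vanishes when below one half. *)
Lemma dist_mod_lt_half (m : int) : dist_mod m%:~R < 2^-1 -> (n %| m)%Z.
Proof.
have [k ->] := dist_mod_attained m%:~R.
have -> : m%:~R - n%:R * k%:~R = (m - n%:Z * k)%:~R :> R by rewrite intrB intrM.
rewrite -intr_norm => h; have {h} : `|m - n%:Z * k| < 1.
  by rewrite -(ltr_int R); apply: lt_trans h _; rewrite invf_lt1 ?ltr1n.
rewrite -[1]add0r ltzD1 normr_le0 subr_eq0 => /eqP ->.
exact: dvdz_mulr.
Qed.

End DistMod.

Lemma ler_dist_max0 (R : realDomainType) (a b : R) :
  `|Num.max 0 a - Num.max 0 b| <= `|a - b|.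
Proof.
have := ler_norm (a - b); have := ler_norm (- (a - b)); rewrite normrN.
move: `|a - b| (normr_ge0 (a - b)) => q q0 *; rewrite ler_norml; apply/andP; split.
  by case: (leP 0 a) => ?; case: (leP 0 b) => ?; lra.
by case: (leP 0 a) => ?; case: (leP 0 b) => ?; lra.
Qed.

(** * Construction of the lift on a geodesic simply connected space *)

Section Winding.
Context {R : realType} {X : metricType R} (x0 : X).
Hypotheses (hsc : simply_connected R X) (hgeo : geodesic X).

(** A geodesic rescaled to [[0, 1]]. The distance bound keeps it inside every ball about [x] that
    contains [y]. *)
Lemma geodesic_path (x y : X) : exists g : R -> X,
  [/\ {within `[0, 1], continuous g}, g 0 = x, g 1 = y &
      forall t, `[0, 1]%classic t -> mdist x (g t) <= mdist x y].
Proof.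
have [xi [xiD xi0 xi1]] := hgeo x y.
have d0 : 0 <= mdist x y by exact: mdist_ge0.
have itvd t : t \in `[0, 1] -> t * mdist x y \in `[0, mdist x y].
  by rewrite !in_itv /= => /andP[t0 t1]; rewrite mulr_ge0 // ler_piMl.
have xiE s t : s \in `[0, 1] -> t \in `[0, 1] ->
    mdist (xi (s * mdist x y)) (xi (t * mdist x y)) = `|s - t| * mdist x y.
  by move=> sI tI; rewrite xiD ?itvd // -mulrBl normrM (ger0_norm d0).
have I0 : (0 : R) \in `[0, 1] by rewrite in_itv /= lexx ler01.
exists (fun t => xi (t * mdist x y)); split.
- apply/within_continuousP => p pI B /nbhs_ballP[e /= e0 eB].
  have d10 : 0 < mdist x y + 1 by lra.
  have : \forall q \near p, ball p (e / (mdist x y + 1)) q.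
    by apply: nbhsx_ballx; exact: divr_gt0.
  apply: filterS => q; rewrite /ball /= => pq qI; apply: eB; apply/in_ballE.
  rewrite xiE //; apply: (@le_lt_trans _ _ (`|p - q| * (mdist x y + 1))).
    by rewrite ler_wpM2l // lerDl.
  by rewrite -ltr_pdivlMr.
- by rewrite mul0r.
- by rewrite mul1r.
- move=> t tI; have := xiE 0 t I0 tI; rewrite mul0r xi0 sub0r normrN => ->.
  by move: tI; rewrite /= in_itv /= => /andP[t0 t1]; rewrite ger0_norm // ler_piMl.
Qed.

(* [G i] is the function [F - b_i] where [F] is a global lift of the circle-valued
   map determined by the cocycle and [b_i = \sum_k rho_k c i k], for the partition
   of unity [rho] obtained from the positive parts of [f]. *)
Lemma tame_lift (I : finType) (f : I -> X -> R^o) (c : I -> I -> int) :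
  (forall i, tame x0 (f i)) -> (forall x, exists i, 1 < f i x) ->
  (forall i j k x, 0 < f i x -> 0 < f j x -> 0 < f k x -> c j k - c i k + c i j = 0) ->
  exists (G : I -> X -> R^o) (m : I -> X -> int),
  [/\ forall i, tame x0 (G i),
      forall i x, 0 < f i x -> G i x = (m i x)%:~R &
      forall i j x, 0 < f i x -> 0 < f j x -> m j x - m i x = c i j].
Proof.
move=> tf f1 cc.
have cii i x : 0 < f i x -> c i i = 0 by move=> fi; have := cc i i i x fi fi fi; lia.
have cC i j x : 0 < f i x -> 0 < f j x -> c j i = - c i j.
  by move=> fi fj; have := cc i j i x fi fj fi; rewrite (cii _ _ fi); lia.
have [j0 j0P] := choice f1.
have fj0 x : 0 < f (j0 x) x by exact: lt_trans (j0P x).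
(* The jump from the label [j0 x] to the label [j0 y] through a common index [k]; the cocycle
   identity makes it independent of [k]. The value [0] for points without a common index is a
   default. *)
pose e x y := if [pick k | (0 < f k x) && (0 < f k y)] is Some k
  then c (j0 x) k + c k (j0 y) else 0.
have eE k x y : 0 < f k x -> 0 < f k y -> e x y = c (j0 x) k + c k (j0 y).
  move=> kx ky; rewrite /e; case: pickP => [l /andP[lx ly]|/(_ k)]; last by rewrite kx ky.
  have := cc (j0 x) l k x (fj0 x) lx kx.
  by have := cc l k (j0 y) y ly ky (fj0 y); lia.
have eadd k : additive_on e [set x | 0 < f k x].
  move=> x y z /= kx ky kz; rewrite !(eE k) // (cC k (j0 y) y) //; lia.
have eloc : loc_additive e setT.
  move=> x _; exists [set y | 0 < f (j0 x) y]; last first.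
    by move=> p q r [_ fp] [_ fq] [_ fr]; exact: (eadd (j0 x)) fp fq fr.
  apply: open_nbhs_nbhs; split; last exact: fj0.
  apply: (@open_comp _ _ (f (j0 x)) [set t | 0 < t]); last exact: open_gt.
  by move=> y _; exact: (tf (j0 x)).1.
have [M MP] := simply_connected_cocycle eloc x0 hsc.
(* The correction removes the dependence on the arbitrary label [j0 x]: between points where [f i]
   is positive, it cancels the jump [e]. *)
pose m i x := M x + c (j0 x) i.
have mB i j x : 0 < f i x -> 0 < f j x -> m j x - m i x = c i j.
  by move=> fi fj; rewrite /m; have := cc (j0 x) i j x (fj0 x) fi fj; lia.
have mball i x r : (forall y, ball x r y -> 0 < f i y) ->
    forall y, ball x r y -> m i y = m i x.
  move=> fb y /[dup] xy /in_ballE xyr; have [g [gC g0 g1 gd]] := geodesic_path x y.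
  have fx : 0 < f i x.
    by apply: fb; apply/in_ballE; rewrite mdistxx; exact: le_lt_trans (mdist_ge0 _ _) xyr.
  have gf t : `[0, 1]%classic t -> 0 < f i (g t).
    by move=> /gd dt; apply: fb; apply/in_ballE; exact: le_lt_trans xyr.
  have := MP _ g (eadd i) gC gf; rewrite g0 g1 (eE i) ?fx ?fb //.
  rewrite /m (cC i (j0 y) y) ?fb //; lia.
pose p k t : R := Num.max 0 (f k t).
have p0 k x : 0 <= p k x by rewrite /p le_max lexx.
have pf k x : 0 < f k x \/ p k x = 0.
  by have [?|?] := ltP 0 (f k x); [left | right; rewrite /p; apply/max_idPl].
pose S t : R := \sum_k p k t.
have pS k x : p k x <= S x by rewrite /S (bigD1 k) //= lerDl sumr_ge0.
(* The threshold [1] on [f] bounds [S] from below, which makes the quotients [p k / S] Lipschitz in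
   terms of the [f k]. *)
have S1 x : 1 <= S x.
  apply: le_trans (pS (j0 x) x); rewrite /p le_max; apply/orP; right; exact/ltW/j0P.
have S0 x : 0 < S x by exact: lt_le_trans (S1 x).
pose D y z : R := \sum_k `|f k y - f k z|.
have D0 y z : 0 <= D y z by exact: sumr_ge0.
have pD k y z : `|p k y - p k z| <= `|f k y - f k z| by exact: ler_dist_max0.
have SD y z : `|S y - S z| <= D y z.
  by rewrite /S -sumrB; apply: le_trans (ler_norm_sum _ _ _) _; apply: ler_sum => k _.
have rhoD k y z : `|p k y / S y - p k z / S z| <= 2 * D y z.
  have -> : p k y / S y - p k z / S z =
      (p k y - p k z) / S y + (p k z / S z) * ((S z - S y) / S y).
    by field; rewrite !gt_eqF.
  have Sle1 x : (S x)^-1 <= 1 by rewrite invf_le1.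
  have quot_le (a b : R) x : `|a| <= b -> `|a / S x| <= b.
    move=> ab; rewrite normrM normfV (gtr0_norm (S0 x)); apply: le_trans ab.
    by rewrite ler_piMr.
  apply: le_trans (ler_normD _ _) _; rewrite mulr_natl mulr2n; apply: lerD.
    apply: quot_le; apply: le_trans (pD k y z) _.
    by rewrite /D (bigD1 k) //= lerDl sumr_ge0.
  rewrite normrM -[leRHS]mul1r; apply: ler_pM => //; last first.
    by apply: quot_le; rewrite distrC.
  by rewrite normrM normfV (gtr0_norm (S0 z)) ger0_norm // ler_pdivrMr // mul1r.
pose G i x : R := (\sum_k p k x * (m k x - c i k)%:~R) / S x.
(* Seen from an index [l], [G i] is the integer [m l], constant on balls where [f l] is positive,
   plus a combination of the [p k / S] with constant coefficients. Indices [k] with [f k x <= 0]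
   have weight zero. *)
have GE i l x a : 0 < f l x -> m l x = a ->
    G i x = a%:~R + \sum_k (p k x / S x) * (c l k - c i k)%:~R.
  move=> fl <-; rewrite /G mulr_suml.
  have -> : (m l x)%:~R = \sum_k (p k x / S x) * (m l x)%:~R :> R.
    by rewrite -mulr_suml -mulr_suml -/(S x) divff ?mul1r // gt_eqF.
  rewrite -big_split /=; apply: eq_bigr => k _; rewrite mulrAC -mulrDr -intrD.
  have [fk|->] := pf k x; last by rewrite !mul0r.
  by congr (_ * _%:~R); have := mB l k x fl fk; lia.
exists G, m; split=> // [i|i x fi]; last first.
  by rewrite (GE i i x _ fi erefl) big1 ?addr0 // => k _; rewrite subrr mulr0.
pose K : R := \sum_l \sum_k \sum_i `|c l k - c i k|%:~R.
have Kc l k i' : `|(c l k - c i' k)%:~R| <= K :> R.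
  rewrite -intr_norm /K (bigD1 l) //= (bigD1 k) //= (bigD1 i') //= -!addrA lerDl.
  by rewrite !addr_ge0 // ?sumr_ge0 // => *; rewrite ?sumr_ge0 // => *;
    rewrite ?sumr_ge0 // => *; rewrite ler0z.
have K0 : 0 <= K.
  by apply: sumr_ge0 => *; apply: sumr_ge0 => *; apply: sumr_ge0 => *; rewrite ler0z.
apply: (@tame_local _ _ _ _ f _ (#|I|%:R * (2 * K))) => //; first by rewrite !mulr_ge0.
move=> l x r r0 fl y z xy xz.
rewrite (GE i l y (m l x)) ?fl ?(mball l x r) // (GE i l z (m l x)) ?fl ?(mball l x r) //.
rewrite opprD addrACA subrr add0r -sumrB; apply: le_trans (ler_norm_sum _ _ _) _.
rewrite -mulrA [#|I|%:R * _]mulr_natl -sumr_const; apply: ler_sum => k _.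
rewrite -mulrBl normrM mulrAC; apply: ler_pM => //; exact: rhoD.
Qed.

End Winding.

(** * Torsion-freeness and divisibility of Cech cohomology *)

Section CechMulrn.
Context {T : topologicalType}.
Implicit Types (r s : @cech_cocycle T).

(** The representative [s] lives on an iterated meet of covers, so it is described by its
    restrictions rather than by a formula. *)
Lemma cech_class_mulrn r n : exists s, cech_class r *+ n = cech_class s /\
  forall W c, restricts r W c -> restricts s W (c *+ n).
Proof.
elim: n => [|n [s [sE sP]]].
  by exists cocycle_zero; split=> // W c _; rewrite mulr0n; exact: restricts_zero.
exists (cocycle_add r s); split; first by rewrite mulrS sE; exact: cech_class_add.
by move=> W c rc; rewrite mulrS; apply: restricts_add => //; exact: sP.
Qed.

Lemma mulrn_cochainE (c : set T -> set T -> int) n u v : (c *+ n) u v = c u v * n%:Z.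
Proof. by rewrite !natmulfctE -mulr_natr natz. Qed.

(** Values of [b] on intersecting sets differ by a multiple of [n.+1], so their Euclidean quotients
    differ by exactly [c]. *)
Lemma coboundary1_torsion (W : set (set T)) (c : set T -> set T -> int) n :
  coboundary1 W (c *+ n.+1) -> coboundary1 W c.
Proof.
move=> [b bP]; exists (fun w => (b w %/ n.+1)%Z) => u v Wu Wv uv.
have := bP u v Wu Wv uv; rewrite mulrn_cochainE => cb.
have -> : b v = c u v * n.+1%:Z + b u by rewrite cb subrK.
by rewrite divzMDl // addrK.
Qed.

Lemma cech_torsion_free : torsion_free (cech_H1 T).
Proof.
move=> n x; rewrite -(cech_class_repr x); set r := repr x.
have [s [-> sP]] := cech_class_mulrn r n.+1.
move=> /cech_class_eqP/cech_cohomologousP[W [c [oW sc zc]]].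
have rd := restricts_self r; set d := cech_cochain r in rd.
(* [W] is known to refine the cover of [s]; the meet makes it refine that of [r] as well. *)
have m1 := @refinement_meet1 _ W (cech_cover r).
have m2 := @refinement_meet2 _ W (cech_cover r).
apply/cech_class_eqP.
apply: (cech_cohomologous_restricts (open_cover_meet oW (cech_coverP r))
  (restricts_refinement rd m2) (restricts_zero _)).
rewrite subr0; apply: (@coboundary1_torsion _ _ n).
have := coboundary1D
  (restricts_uniq (sP _ _ (restricts_refinement rd m2)) (restricts_refinement sc m1))
  (restricts_uniq (restricts_refinement zc m1) (restricts_zero _)).
by rewrite subr0 subrK.
Qed.

End CechMulrn.

(** * Divisibility of the Cech cohomology of the compactification *)

Section Divisible.
Context {R : realType} {X : metricType R} (x0 : X).
Local Notation Y := (higson x0).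

Lemma to_higson_near (z : Y) B : nbhs z B -> exists x, B (to_higson x0 x).
Proof.
rewrite nbhsE => -[V [oV Vz] VB]; have [x Vx] := to_higson_dense oV (ex_intro _ z Vz).
by exists x; exact: VB.
Qed.

(** Compactness is applied to the sets where some function exceeds [1], although positivity already
    confines a point to a member of [U]; [tame_lift] needs this margin. *)
Lemma higson_finite_cover (U : set (set Y)) : open_cover U ->
  exists (I : finType) (f : I -> higson_functions x0) (u : I -> set Y),
  [/\ forall i, U (u i), forall i w, 0 < higson_eval (f i) w -> u i w &
      forall w, exists i, 1 < higson_eval (f i) w].
Proof.
move=> [oU cU].
pose T : ptopologicalType := HB.pack (Topological.sort Y) (isPointed.Build Y (to_higson x0 x0)).
pose D := [set f : higson_functions x0 |
  exists2 u, U u & forall w, 0 < higson_eval f w -> u w].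
have : cover_compact [set: T] by rewrite -compact_cover; exact: higson_compact.
move=> /(_ _ D (fun f => [set w | 1 < higson_eval f w]))[].
- move=> f _; apply: (@open_comp _ _ (higson_eval f) [set t | 1 < t]); last exact: open_gt.
  by move=> w _; exact: higson_eval_continuous.
- move=> z _; have [u Uu uz] : (\bigcup_(u in U) u) z by rewrite cU.
  have [f [fz fu]] := higson_base (oU _ Uu) uz.
  by exists f => //; exists u.
move=> D' D'D D'cov.
have uex (i : D') : exists u : set Y, U u /\ forall w, 0 < higson_eval (val i) w -> u w.
  by case: i => f /= fD'; have [u Uu fu] := set_mem (D'D f fD'); exists u.
have [u uP] := choice uex.
exists D', val, u; split=> [i|i|w]; [exact: (uP i).1 | exact: (uP i).2 |].
by have [f fD' fw] := D'cov w I; exists (FSetSub fD').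
Qed.

Hypotheses (hsc : simply_connected R X) (hgeo : geodesic X).

(** Each member of the refined cover fixes a residue [a] of the lift modulo [n.+1]. The cocycle
    minus the coboundary of [a] is then a multiple of [n.+1], and the quotient is the cochain of
    [s]. *)
Lemma divisible_cochain (r : @cech_cocycle Y) (n : nat) : exists (s : @cech_cocycle Y) p a,
  refinement (cech_cover s) (cech_cover r) p /\
  forall u v, cech_cover s u -> cech_cover s v -> u `&` v !=set0 ->
    cech_cochain r (p u) (p v) = cech_cochain s u v * n.+1%:Z + (a v - a u).
Proof.
set U := cech_cover r; set c := cech_cochain r.
have [I [f [u [uU fu fI]]]] := higson_finite_cover (cech_coverP r).
pose F i : X -> R^o := set_val (f i).
have FE i x : F i x = higson_eval (f i) (to_higson x0 x) by [].
have Fu i x : 0 < F i x -> u i (to_higson x0 x) by rewrite FE; exact: fu.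
have [|||G [m [tG GE mc]]] := @tame_lift _ _ x0 hsc hgeo I F (fun i j => c (u i) (u j)).
- by move=> i; apply: higson_tame; exact: (set_mem (valP (f i))).
- by move=> x; have [i fx] := fI (to_higson x0 x); exists i; rewrite FE.
- move=> i j k x /Fu ui /Fu uj /Fu uk.
  by apply: (@cech_cochainP _ r) => //; exists (to_higson x0 x).
(* The distance of [G i] to the class of [a] modulo [n.+1]: bounded, unlike [G i], hence extendable
   to the compactification. *)
pose psi i (a : int) x : R^o := dist_mod n.+1 (G i x - a%:~R).
have psiH i a : higson_functions x0 (psi i a).
  apply: (@tame_higson _ _ _ _ n.+1%:R) => [x|]; first exact: dist_mod_bounded.
  apply: (@tame_dom1 _ _ _ _ _ 1 _ (tG i)) => // x y; rewrite mul1r.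
  by apply: le_trans (dist_mod_lipschitz _ _ _) _; rewrite // opprD addrACA subrr addr0.
pose ev i a := higson_eval (higson_fun (psiH i a)).
pose V (l : I * 'I_n.+1) : set Y :=
  [set z | 0 < higson_eval (f l.1) z /\ ev l.1 l.2 z < 2^-1].
have [i0 _] := fI (to_higson x0 x0).
pose W := range V.
(* Covers are sets of sets, so an index and a residue have to be chosen for each member; sets
   outside [W] get a dummy label. *)
have labex (w : set Y) : exists l, W w -> V l = w.
  by have [[l _ lw]|nW] := pselect (W w); [exists l | exists (i0, ord0)].
have [lab labP] := choice labex.
have WE w x : W w -> w (to_higson x0 x) ->
    0 < F (lab w).1 x /\ exists k, m (lab w).1 x = (lab w).2%:Z + k * n.+1%:Z.
  move=> Ww; rewrite -{1}(labP w Ww) => -[fw evw]; split=> //.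
  have : dist_mod n.+1 (m (lab w).1 x - (lab w).2%:Z)%:~R < 2^-1 :> R.
    by rewrite intrB -GE.
  move=> /dist_mod_lt_half/dvdzP[//|k mk]; exists k.
  by rewrite -mk addrC subrK.
have oW : open_cover W.
  split.
    move=> _ [[i a] _ <-]; apply: openI.
      apply: (@open_comp _ _ (higson_eval (f i)) [set t | 0 < t]); last exact: open_gt.
      by move=> w _; exact: higson_eval_continuous.
    apply: (@open_comp _ _ (ev i a) [set t | t < 2^-1]); last exact: open_lt.
    by move=> w _; exact: higson_eval_continuous.
  rewrite -subTset => z _; have [i fz] := fI z.
  have [[a az]|na] := pselect (exists a : 'I_n.+1, ev i a z < 2^-1).
    exists (V (i, a)); first by exists (i, a).
    by split=> //=; exact: lt_trans fz.
  (* If no residue fits at [z], all distances stay above [4^-1] near [z]. This neighbourhood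
     contains a point of [X], where [m i] is an integer and its own residue has distance [0]. *)
  have : \forall w \near z, 1 < higson_eval (f i) w /\ forall a : 'I_n.+1, 4^-1 < ev i a w.
    apply: filterI.
      apply: (@higson_eval_continuous _ _ _ (f i) z [set t | 1 < t]).
      by apply: open_nbhs_nbhs; split=> //; exact: open_gt.
    apply: (@filter_forall _ _ (fun (a : 'I_n.+1) w => 4^-1 < ev i a w) (nbhs z)
      (nbhs_filter z)) => a.
    apply: (@higson_eval_continuous _ _ _ (higson_fun (psiH i a)) z [set t | 4^-1 < t]).
    apply: open_nbhs_nbhs; split; first exact: open_gt.
    have : 2^-1 <= ev i a z by rewrite leNgt; apply/negP => h; apply: na; exists a.
    by apply: lt_le_trans; lra.
  move=> /to_higson_near[x [fx ax]].
  have nz : n.+1%:Z != 0 by [].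
  have ltn : (`|(m i x %% n.+1)%Z| < n.+1)%N.
    by rewrite -ltz_nat gez0_abs ?modz_ge0 // ltz_mod.
  have : 4^-1 < psi i `|(m i x %% n.+1)%Z|%N%:Z x by exact: (ax (Ordinal ltn)).
  rewrite /psi.
  rewrite GE; last exact: lt_trans fx.
  rewrite -intrB gez0_abs ?modz_ge0 //.
  rewrite {1}(divz_eq (m i x) n.+1%:Z) addrK mulrC intrM dist_mod0 // => h.
  by move: h; rewrite ltNge invr_ge0 ler0n.
pose p w := u (lab w).1; pose a w : int := (lab w).2%:Z.
pose d v w := ((c (p v) (p w) - (a w - a v)) %/ n.+1%:Z)%Z.
have dE v w : W v -> W w -> v `&` w !=set0 ->
    c (p v) (p w) = d v w * n.+1%:Z + (a w - a v).
  move=> Wv Ww vw.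
  (* By density the intersection contains a point of [X], where [c] is a difference of values of [m]
     and these have the residues named by the labels. *)
  have [x [vx wx]] := to_higson_dense (openI (oW.1 _ Wv) (oW.1 _ Ww)) vw.
  have [fv [k mk]] := WE v x Wv vx; have [fw [l ml]] := WE w x Ww wx.
  have cE : c (p v) (p w) - (a w - a v) = (l - k) * n.+1%:Z.
    by rewrite /p -(mc _ _ x) // mk ml /a; ring.
  by rewrite /d cE mulzK // -cE subrK.
have Wp : refinement W U p.
  move=> w Ww; split; first exact: uU.
  by rewrite -{1}(labP w Ww) => z [fz _]; exact: fu.
have dC : cocycle1 W d.
  move=> v w t Wv Ww Wt vwt.
  have cC := cocycle1_pullback Wp (@cech_cochainP _ r) Wv Ww Wt vwt.
  have [z [[vz wz] tz]] := vwt.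
  have := dE v w Wv Ww (ex_intro _ z (conj vz wz)).
  have := dE v t Wv Wt (ex_intro _ z (conj vz tz)).
  have := dE w t Ww Wt (ex_intro _ z (conj wz tz)).
  move: cC; rewrite /pullback1 -/c => cC e1 e2 e3.
  have : (d w t - d v t + d v w) * n.+1%:Z = 0.
    have -> : 0 = c (p w) (p t) - c (p v) (p t) + c (p v) (p w) by rewrite cC.
    by rewrite e1 e2 e3; ring.
  by move=> /eqP; rewrite mulf_eq0 orbF => /eqP.
by exists (CechCocycle oW dC), p, a.
Qed.

Theorem higson_cech_divisible : divisible (cech_H1 Y).
Proof.
move=> n x; rewrite -(cech_class_repr x); set r := repr x.
have [s [p [a [sp rs]]]] := divisible_cochain r n.
exists (cech_class s); have [t [-> tP]] := cech_class_mulrn s n.+1.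
apply/cech_class_eqP.
apply: (cech_cohomologous_restricts (cech_coverP s) (tP _ _ (restricts_self s))
  (restricts_refinement (restricts_self r) sp)).
exists (- a) => u v su sv uv.
rewrite !fctE mulrn_cochainE /pullback1 rs //; ring.
Qed.

End Divisible.

Theorem proposition2p3 (R : realType) (X : metricType R) (x0 : X)
    (hsc : simply_connected R X) (hgeo : geodesic X) :
  exists (A : choiceType) (phi : {additive cech_H1 (higson x0) -> {freeg A / rat}}),
    bijective phi.
Proof.
apply: divisible_freeg; first exact: cech_torsion_free.
exact: higson_cech_divisible.
Qed.
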